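(* Let $n\ge 1$ and let $\Gamma=\langle\alpha_0,\dots,\alpha_{n-2},\alpha_{n-1},\beta_{n-1}\rangle$ be a tail-triangle C-group, where $\alpha_{n-1}\beta_{n-1}$ has period $k$, $2\le k\le\infty$. Let $\mathcal{P}$ and $\mathcal{Q}$ be the regular $n$-polytopes associated with the string C-groups $\Gamma_n^{\mathcal{P}}=\langle\alpha_0,\dots,\alpha_{n-2},\alpha_{n-1}\rangle$ and $\Gamma_n^{\mathcal{Q}}=\langle\alpha_0,\dots,\alpha_{n-2},\beta_{n-1}\rangle$, and let $\mathcal{S}=\mathcal{S}(\Gamma)$ be the ranked poset of cosets defined in the context. Then: (1) $\mathcal{S}$ is a semiregular abstract $(n+1)$-polytope. (2) Every facet of $\mathcal{S}$ is isomorphic to $\mathcal{P}$ or $\mathcal{Q}$, with $k$ facets of type $\mathcal{P}$ and $k$ facets of type $\mathcal{Q}$ occurring alternately around each face $\mathcal{R}$ of co-rank $2$ (i.e. of rank $n-2$). Thus each $2$-section $\mathcal{S}/\mathcal{R}$ (the co-face of $\mathcal{S}$ at $\mathcal{R}$) is a $2k$-gon (an infinite polygon if $k=\infty$). (3) The face-wise $\Gamma$-stabilizer of any ridge $F$ of $\mathcal{S}$ (the set of elements of $\Gamma$ fixing every face $G\le F$) is trivial. (4) If $n\ge2$, each vertex-figure of $\mathcal{S}$ is isomorphic to the semiregular $n$-polytope $\hat{\mathcal{S}}=\mathcal{S}(\Gamma_0)$ obtained by applying the same construction to the tail-triangle C-group $\Gamma_0=\langle\alpha_1,\dots,\alpha_{n-2},\alpha_{n-1},\beta_{n-1}\rangle$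 with its generators in this order.
   Context: **Polytopes.** An abstract $n$-polytope is a poset with: (A) a strictly monotone rank function with range $\{-1,0,\dots,n\}$, a unique least face $F_{-1}$, a unique greatest face $F_n$, and every maximal chain (flag) containing exactly $n+2$ faces; (B) whenever $F<G$ with $\mathrm{rank}(F)=j-1$, $\mathrm{rank}(G)=j+1$, there are exactly two $j$-faces $H$ with $F<H<G$; (C) for every section $G/F:=\{H: F\le H\le G\}$ the flag graph (flags adjacent when they differ in exactly one face) is connected. Faces of rank $0$, $n-1$, $n-2$ of an $n$-polytope are vertices, facets, ridges (so in an $(n+1)$-polytope facets have rank $n$ and ridges rank $n-1$). A face $G$ is identified with the section $G/F_{-1}$. The co-face at $F$ is the section $F_n/F$, and the co-rank of $F$ is the rank $n-1-\mathrm{rank}(F)$ of this section; the co-face at a vertex is its vertex-figure. The automorphism group of a polytope consists of its order-preserving bijections (with order-preserving inverse). A polytope is regular if its automorphism group is transitive on flags, and semiregular if its facets are regular and its automorphism group is transitive on vertices. **C-groups.** A group generated by a specified list of involutions is a C-group if $\langle I\rangle\cap\langle J\rangle=\langle I\cap J\rangle$ for all subsets $I,J$ of the list of generators. It is a string C-group if moreover the generators can be listed as $\rho_0,\dots,\rho_{n-1}$ (in the given order) with $\rho_i\rho_j=\rho_j\rho_i$ whenever $|i-j|>1$. Every string C-group $\langle\rho_0,\dots,\rho_{n-1}\rangle$ is the automorphism group of an associated regular $n$-polytope, whose $j$-faces ($0\le j\le n-1$) are the right cosets of $\langle\rho_i: i\ne j\rangle$, with $j$-face $<$ $k$-face iff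 $j<k$ and the cosets intersect (together with a least and a greatest face). **Tail-triangle C-groups.** A tail-triangle group is a group $\Gamma=\langle\alpha_0,\dots,\alpha_{n-2},\alpha_{n-1},\beta_{n-1}\rangle$ ($n\ge1$) generated by involutions such that $\alpha_i\alpha_j=\alpha_j\alpha_i$ whenever $|i-j|>1$, $\alpha_i\beta_{n-1}=\beta_{n-1}\alpha_i$ for $i\le n-3$, and $\alpha_{n-1}\beta_{n-1}$ has period $k$ for some $2\le k\le\infty$. (If $n=1$, $\Gamma=\langle\alpha_0,\beta_0\rangle$ is dihedral of order $2k$.) It is a tail-triangle C-group if in addition it is a C-group with respect to these generators. **The poset $\mathcal{S}(\Gamma)$.** Its improper faces are two distinct copies $\Gamma_{-1},\Gamma_{n+1}$ of $\Gamma$. For $0\le j\le n-2$ the $j$-faces are all right cosets in $\Gamma$ of $\Gamma_j:=\langle\alpha_0,\dots,\alpha_{j-1},\alpha_{j+1},\dots,\alpha_{n-1},\beta_{n-1}\rangle$. The $(n-1)$-faces (ridges) are all right cosets of $\Gamma_{n-1}:=\langle\alpha_0,\dots,\alpha_{n-2}\rangle$. The $n$-faces (facets) are all right cosets of $\Gamma_n^{\mathcal{P}}$ (facets of type $\mathcal{P}$) and all right cosets of $\Gamma_n^{\mathcal{Q}}$ (facets of type $\mathcal{Q}$); $\Gamma_n$ denotes either of these two subgroups. Put $\Gamma_j\nu<\Gamma_k\mu$ iff $-1\le j<k\le n+1$ and $\Gamma_j\nu\cap\Gamma_k\mu\ne\emptyset$; and $\Gamma_j\nu\le\Gamma_k\mu$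 iff $\Gamma_j\nu<\Gamma_k\mu$ or ($j=k$ and $\Gamma_j\nu=\Gamma_k\mu$). $\Gamma$ acts on $\mathcal{S}(\Gamma)$ by right multiplication. *)

(* Defs.v *)
From mathcomp Require Import all_boot all_order all_algebra.
From mathcomp Require Import boolp classical_sets functions cardinality.
From Stdlib Require Import Relation_Definitions Relation_Operators.

Set Implicit Arguments.
Unset Strict Implicit.
Unset Printing Implicit Defensive.

Local Open Scope classical_set_scope.
Local Open Scope card_scope.

(* Only data: the poset laws are part of [is_polytope], since transitivity and
   antisymmetry of the coset orders below are not available a priori. *)
Record ranked := Ranked {
  face :> Type;
  fle : face -> face -> Prop;
  rk : face -> int }.

Definition flt (P : ranked) (F G : P) : Prop := fle F G /\ F <> G.

Definition is_least (P : ranked) (F : P) : Prop := forall G : P, fle F G.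

Definition is_greatest (P : ranked) (F : P) : Prop := forall G : P, fle G F.

Definition chain (P : ranked) (C : set P) : Prop :=
  forall F G, C F -> C G -> fle F G \/ fle G F.

Definition flag (P : ranked) (C : set P) : Prop :=
  chain C /\ forall D, chain D -> C `<=` D -> D = C.

Definition flag_adjacent (P : ranked) (C D : set P) : Prop :=
  [/\ flag C, flag D,
      exists F, C `\` D = [set F] & exists F, D `\` C = [set F]].

Definition flag_connected (P : ranked) : Prop :=
  forall C D : set P, flag C -> flag D ->
    clos_refl_trans (set P) (@flag_adjacent P) C D.

(* The section G/F, with its own rank function (F gets rank -1). *)
Definition section (P : ranked) (F G : P) : ranked :=
  @Ranked {H : P | fle F H /\ fle H G}
    (fun H K => fle (sval H) (sval K))
    (fun H => (rk (sval H) - rk F - 1)%R).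

Record is_polytope (n : nat) (P : ranked) : Prop := {
  polytope_order : order P (@fle P);
  polytope_rk_mono : forall F G : P, flt F G -> (rk F < rk G)%R;
  polytope_rk_range : range (@rk P) = [set j : int | (-1 <= j <= n%:Z)%R];
  polytope_least : exists! F : P, is_least F;
  polytope_greatest : exists! F : P, is_greatest F;
  polytope_flag_card : forall C : set P, flag C -> C #= `I_n.+2;
  polytope_diamond : forall (j : int) (F G : P), flt F G ->
    rk F = (j - 1)%R -> rk G = (j + 1)%R ->
    [set H | [/\ rk H = j, flt F H & flt H G]] #= `I_2;
  polytope_connected : forall F G : P, fle F G ->
    flag_connected (section F G) }.

Definition is_iso (P Q : ranked) (f : P -> Q) : Prop :=
  bijective f /\ forall F G, fle F G <-> fle (f F) (f G).

Definition isomorphic (P Q : ranked) : Prop := exists f : P -> Q, is_iso f.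

Definition is_regular (P : ranked) : Prop :=
  forall C D : set P, flag C -> flag D ->
    exists2 f : P -> P, is_iso f & f @` C = D.

Definition is_semiregular (n : nat) (P : ranked) : Prop :=
  (forall F0 F : P, is_least F0 -> rk F = (n%:Z - 1)%R ->
     is_regular (section F0 F)) /\
  (forall F G : P, rk F = 0%R -> rk G = 0%R ->
     exists2 f : P -> P, is_iso f & f F = G).

(* In the rest of the file, elements of [option nat] stand for elements of
   {0, 1, ...} plus infinity, with [None] for infinity. *)
Definition has_card (T : Type) (A : set T) (k : option nat) : Prop :=
  if k is Some m then A #= `I_m else A #= [set: nat].

Variant polygon_face (I : Type) : Type :=
  | PBot | PVertex of I | PEdge of I | PTop.
Arguments PBot {I}.
Arguments PTop {I}.

(* The edge [i] joins the vertices [i] and [s i]. *)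
Definition polygon_le (I : Type) (s : I -> I) (F G : polygon_face I) : Prop :=
  match F, G with
  | PBot, _ | _, PTop => True
  | PVertex i, PVertex j => i = j
  | PVertex i, PEdge j => i = j \/ i = s j
  | PEdge i, PEdge j => i = j
  | _, _ => False
  end.

Definition polygon_rk (I : Type) (F : polygon_face I) : int :=
  match F with
  | PBot => (-1)%R
  | PVertex _ => 0%R
  | PEdge _ => 1%R
  | PTop => 2%R
  end.

Definition polygon_index (m : option nat) : Type :=
  if m is Some m' then 'I_m' else int.

Definition polygon_succ (m : option nat) : polygon_index m -> polygon_index m :=
  match m with
  | Some m' => @ordS m'
  | None => fun i : int => (i + 1)%R
  end.

(* The m-gon; for m infinite, the infinite polygon with vertex set Z. *)
Definition polygon (m : option nat) : ranked :=
  @Ranked (polygon_face (polygon_index m)) (polygon_le (@polygon_succ m))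
    (@polygon_rk (polygon_index m)).

Definition is_subgroup (gT : groupType) (H : set gT) : Prop :=
  H 1%g /\ forall x y, H x -> H y -> H (x * y^-1)%g.

(* The subgroup generated by the [g i] with [i] in [I]. *)
Definition gen_by (gT : groupType) (g : nat -> gT) (I : set nat) : set gT :=
  smallest (@is_subgroup gT) (g @` I).

Definition rcoset (gT : groupType) (H : set gT) (x : gT) : set gT :=
  [set (h * x)%g | h in H].

Definition involution (gT : groupType) (x : gT) : Prop :=
  x <> 1%g /\ (x ^+ 2 = 1)%g.

Definition has_period (gT : groupType) (x : gT) (k : option nat) : Prop :=
  match k with
  | Some m => [/\ (0 < m)%N, (x ^+ m = 1)%g
                & forall j, (0 < j < m)%N -> (x ^+ j)%g <> 1%g]
  | None => forall j, (0 < j)%N -> (x ^+ j)%g <> 1%g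
  end.

(* The list of generators is [g 0, ..., g (m - 1)]; the other values of [g] are
   irrelevant.  Subsets of the list are subsets of the set of indices. *)
Definition is_C_group (gT : groupType) (m : nat) (g : nat -> gT) : Prop :=
  (forall i, (i < m)%N -> involution (g i)) /\
  forall I J : set nat, I `<=` `I_m -> J `<=` `I_m ->
    gen_by g I `&` gen_by g J = gen_by g (I `&` J).

(* A face is a pair (rank, coset); [K j H] says that the right cosets in
   [Gamma] of [H] are faces of rank [j]. *)
Definition is_coset_face (gT : groupType) (Gamma : set gT)
    (K : int -> set gT -> Prop) (F : int * set gT) : Prop :=
  exists H x, [/\ K F.1 H, Gamma x & F.2 = rcoset H x].

Definition coset_poset (gT : groupType) (Gamma : set gT)
    (K : int -> set gT -> Prop) : ranked :=
  @Ranked {F : int * set gT | is_coset_face Gamma K F}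
    (fun F G =>
       ((sval F).1 < (sval G).1)%R /\ (sval F).2 `&` (sval G).2 !=set0 \/
       (sval F).1 = (sval G).1 /\ (sval F).2 = (sval G).2)
    (fun F => (sval F).1).

(* The least and greatest faces are encoded as two copies of the whole group. *)
Variant string_type (gT : groupType) (n : nat) (r : nat -> gT) :
    int -> set gT -> Prop :=
  | string_type_bot : string_type n r (-1)%R (gen_by r `I_n)
  | string_type_proper (j : nat) of (j < n)%N :
      string_type n r j%:Z%R (gen_by r (`I_n `\ j))
  | string_type_top : string_type n r n%:Z%R (gen_by r `I_n).

(* The polytope associated with the string C-group <r 0, ..., r (n - 1)>. *)
Definition string_poset (gT : groupType) (n : nat) (r : nat -> gT) : ranked :=
  coset_poset (gen_by r `I_n) (string_type n r).

(* A tail-triangle group is given by [n], by [a] with [a i] = alpha_i for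
   [i < n] (the other values of [a] are irrelevant), and by [b] = beta_(n-1);
   the group is the subgroup [tt_group n a b] they generate in [gT].
   [tt_gens n a b] lists alpha_0, ..., alpha_(n-1), beta_(n-1), and
   [tt_gensQ n a b] lists alpha_0, ..., alpha_(n-2), beta_(n-1). *)
Definition tt_gens (gT : groupType) (n : nat) (a : nat -> gT) (b : gT) :
  nat -> gT := fun i => if i == n then b else a i.

Definition tt_gensQ (gT : groupType) (n : nat) (a : nat -> gT) (b : gT) :
  nat -> gT := fun i => if i == n.-1 then b else a i.

Record tail_triangle_C_group (gT : groupType) (n : nat) (a : nat -> gT)
    (b : gT) (k : option nat) : Prop := {
  tt_rank : (1 <= n)%N;
  tt_involution : forall i, (i <= n)%N -> involution (tt_gens n a b i);
  tt_comm_aa : forall i j, (i < n)%N -> (j < n)%N -> (i.+1 < j)%N ->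
    commute (a i) (a j);
  tt_comm_ab : forall i, (i + 3 <= n)%N -> commute (a i) b;
  tt_period_ge2 : if k is Some m then (2 <= m)%N else true;
  tt_period : has_period (a n.-1 * b)%g k;
  tt_C_group : is_C_group n.+1 (tt_gens n a b) }.

Definition tt_group (gT : groupType) (n : nat) (a : nat -> gT) (b : gT) :
  set gT := gen_by (tt_gens n a b) `I_n.+1.

Variant S_type (gT : groupType) (n : nat) (a : nat -> gT) (b : gT) :
    int -> set gT -> Prop :=
  | S_type_bot : S_type n a b (-1)%R (tt_group n a b)
  | S_type_proper (j : nat) of (j + 2 <= n)%N :
      S_type n a b j%:Z%R (gen_by (tt_gens n a b) (`I_n.+1 `\ j))
  | S_type_ridge : S_type n a b (n%:Z - 1)%R (gen_by a `I_n.-1)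
  | S_type_facetP : S_type n a b n%:Z%R (gen_by a `I_n)
  | S_type_facetQ : S_type n a b n%:Z%R (gen_by (tt_gensQ n a b) `I_n)
  | S_type_top : S_type n a b (n%:Z + 1)%R (tt_group n a b).

Definition S_poset (gT : groupType) (n : nat) (a : nat -> gT) (b : gT) :
  ranked := coset_poset (tt_group n a b) (S_type n a b).

Definition facet_of_typeP (gT : groupType) (n : nat) (a : nat -> gT) (b : gT)
    (F : S_poset n a b) : Prop :=
  rk F = n%:Z%R /\
  exists2 x, tt_group n a b x & (sval F).2 = rcoset (gen_by a `I_n) x.

Definition facet_of_typeQ (gT : groupType) (n : nat) (a : nat -> gT) (b : gT)
    (F : S_poset n a b) : Prop :=
  rk F = n%:Z%R /\
  exists2 x, tt_group n a b x
           & (sval F).2 = rcoset (gen_by (tt_gensQ n a b) `I_n) x.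

(* Right multiplication by [x] preserves ranks, so [x] fixes a face iff it
   fixes the underlying coset. *)
Definition facewise_stabilizer (gT : groupType) (n : nat) (a : nat -> gT)
    (b : gT) (F : S_poset n a b) : set gT :=
  [set x | tt_group n a b x /\
           forall G : S_poset n a b, fle G F -> rcoset (sval G).2 x = (sval G).2].

Lemma gen_by1 (gT : groupType) (g : nat -> gT) (I : set nat) : gen_by g I 1%g.
Proof. by move=> H [[H1 _] _]. Qed.

Lemma rcoset1 (gT : groupType) (H : set gT) : rcoset H 1%g = H.
Proof.
by apply/seteqP; split=> [_ [h Hh <-]|h Hh]; [rewrite mulg1|exists h; rewrite ?mulg1].
Qed.

Lemma S_bot_subproof (gT : groupType) (n : nat) (a : nat -> gT) (b : gT) :
  is_coset_face (tt_group n a b) (S_type n a b) ((-1)%R, tt_group n a b).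
Proof.
exists (tt_group n a b), 1%g; split; [exact: S_type_bot|exact: gen_by1|].
by rewrite rcoset1.
Qed.

Lemma S_top_subproof (gT : groupType) (n : nat) (a : nat -> gT) (b : gT) :
  is_coset_face (tt_group n a b) (S_type n a b) ((n%:Z + 1)%R, tt_group n a b).
Proof.
exists (tt_group n a b), 1%g; split; [exact: S_type_top|exact: gen_by1|].
by rewrite rcoset1.
Qed.

Definition S_bot (gT : groupType) (n : nat) (a : nat -> gT) (b : gT) :
  S_poset n a b := exist _ _ (S_bot_subproof n a b).

Definition S_top (gT : groupType) (n : nat) (a : nat -> gT) (b : gT) :
  S_poset n a b := exist _ _ (S_top_subproof n a b).

(* Main.v *)
Require Import Defs.
From mathcomp Require Import all_boot all_order all_algebra.
From mathcomp Require Import boolp classical_sets functions cardinality.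
From mathcomp Require Import zify.
From Stdlib Require Import Relation_Definitions Relation_Operators.

Local Open Scope classical_set_scope.

(** Why the theorem is true.  Call a chamber a pair of an element [x] of the
    group and a type, P or Q, of facet.  Translating by [x] the base flag of that
    type gives a flag of the coset poset, and everything about the poset can be
    read off from which faces two chambers share.  By the intersection property,
    the chambers [x] and [y] share a set of faces iff [x y^-1] lies in the
    subgroup generated by the generators that fix all of the corresponding base
    faces ([S_agree]); the type enters at one position only, that of the facets.

    Three facts about chambers make the poset a polytope ([chambers_polytope]).
    Exchange ([S_exchange]): two chambers through a common face combine into one
    that has the lower faces of the first and the upper faces of the second,
    because the stabilizer of a base face is the product of the groups of the two
    parts into which its node cuts the diagram.  Exchange gives transitivity of
    the order and shows that every flag, of the poset or of one of its sections,
    comes from a chamber.  Thinness: the neighbours of [x] are its products with a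
    generator that fixes the facet of the chamber, and the chamber of the other
    type over [x]; the diamond condition follows.  Connectedness ([S_conn]):
    chambers that agree outside a range of ranks differ by a product of
    generators that move faces in that range only, and each generator is a step,
    or, if it moves the facet, a step taken after changing the type and before
    changing it back.

    Right multiplication is transitive on the chambers of a given type, which
    gives the regularity of facets and transitivity on vertices.  Facets,
    vertex-figures and faces of co-rank 2 are identified by one principle
    ([chamber_map_iso]): a map of chambers that preserves and reflects the
    sharing of faces is an isomorphism of a poset onto a section.  For facets and
    vertex-figures this map is a translation, and again the intersection property
    says which faces are shared.  For a face of co-rank 2 it is the walk
    [1, u, v u, u v u, ...] around the dihedral group generated by the last two
    generators [u] and [v]: its elements stand for the ridges, consecutive ones
    lie in a common facet, and the types of these facets alternate.  Finally, no
    generator fixes all the base faces up to a ridge, so the facewise stabilizer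
    of a ridge is trivial. *)

Set Implicit Arguments.
Unset Strict Implicit.

(** * Ranked posets described by chambers *)

(** A chamber stands for a flag: [phi x r] is the face of rank [r - 1] of the
    chamber [x].  The shift makes the positions [0, ..., M] natural numbers;
    values of [phi x] beyond [M] are junk. *)
Record chambering (P : ranked) (M : nat) (X : Type) (phi : X -> nat -> P) :
    Prop := {
  ch_rk : forall x r, r <= M -> rk (phi x r) = (r%:Z - 1)%R;
  ch_surj : forall F : P, exists x r, r <= M /\ F = phi x r;
  ch_le : forall F G : P, fle F G <->
    exists x r s, [/\ r <= s, s <= M, F = phi x r & G = phi x s] }.

(** The exchange property says that two chambers through a common face can be
    recombined into a third one.  It is what makes the order transitive and
    lets every chain be completed to a chamber. *)
Record exchange (P : ranked) (M : nat) (X : Type) (phi : X -> nat -> P) :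
    Prop := {
  ex_bot : forall x y, phi x 0 = phi y 0;
  ex_top : forall x y, phi x M = phi y M;
  ex_mix : forall x y r, r <= M -> phi x r = phi y r -> exists z,
    (forall s, s <= r -> phi z s = phi x s) /\
    (forall s, r <= s -> s <= M -> phi z s = phi y s) }.

Definition adjacent_at (P : ranked) (M : nat) (X : Type) (phi : X -> nat -> P)
    (r : nat) (x y : X) : Prop :=
  forall s, s <= M -> (phi x s = phi y s <-> s <> r).

Definition agree_off (P : ranked) (M : nat) (X : Type) (phi : X -> nat -> P)
    (i k : nat) (x y : X) : Prop :=
  forall s, s <= M -> s <= i \/ k <= s -> phi x s = phi y s.

Definition chamber_path (P : ranked) (M : nat) (X : Type) (phi : X -> nat -> P)
    (i k : nat) : X -> X -> Prop :=
  clos_refl_trans X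
    (fun x y => exists r, i < r < k /\ adjacent_at M phi r x y).

Definition flag_of (P : ranked) (M : nat) (X : Type) (phi : X -> nat -> P)
    (x : X) : set P := [set F | exists2 r, r <= M & F = phi x r].

Section Flags.
Variables (P : ranked) (M : nat) (X : Type) (phi : X -> nat -> P).
Hypothesis chP : chambering M phi.

Lemma chamber_rank_inj x y r s :
  r <= M -> s <= M -> phi x r = phi y s -> r = s.
Proof.
move=> rM sM e; have := ch_rk chP x rM.
by rewrite e (ch_rk chP y sM); lia.
Qed.

Lemma chamber_le x r s : r <= s -> s <= M -> fle (phi x r) (phi x s).
Proof. by move=> rs sM; apply/(ch_le chP); exists x, r, s. Qed.

Lemma chamber_le_rank x y r s :
  r <= M -> s <= M -> fle (phi x r) (phi y s) -> r <= s.
Proof.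
move=> rM sM /(ch_le chP)[z [r' [s' [rs' sM' e1 e2]]]].
have -> := chamber_rank_inj rM (leq_trans rs' sM') e1.
by have -> := chamber_rank_inj sM sM' e2.
Qed.

Lemma chamber_le_eq x y r : r <= M -> fle (phi x r) (phi y r) ->
  phi x r = phi y r.
Proof.
move=> rM /(ch_le chP)[z [r' [s' [rs' sM' e1 e2]]]].
have er := chamber_rank_inj rM (leq_trans rs' sM') e1.
have es := chamber_rank_inj rM sM' e2.
by rewrite e1 e2 -er -es.
Qed.

Lemma chamber_le_common x y r s : r <= M -> s <= M ->
  fle (phi x r) (phi y s) -> exists2 z, phi z r = phi x r & phi z s = phi y s.
Proof.
move=> rM sM /(ch_le chP)[z [r' [s' [rs' sM' e1 e2]]]].
have er := chamber_rank_inj rM (leq_trans rs' sM') e1.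
have es := chamber_rank_inj sM sM' e2.
by exists z; [rewrite e1 -er|rewrite e2 -es].
Qed.

Lemma flag_of_chain x : chain (flag_of M phi x).
Proof.
move=> _ _ [r rM ->] [s sM ->].
by case: (leqP r s) => h; [left|right]; apply: chamber_le => //; apply: ltnW.
Qed.

Lemma chamber_rank_ex (F : P) r : rk F = (r%:Z - 1)%R -> r <= M /\
  exists x, F = phi x r.
Proof.
have [x [s [sM ->]]] := ch_surj chP F; rewrite (ch_rk chP) // => e.
have es : s = r by lia.
by rewrite -es; split=> //; exists x.
Qed.

Hypothesis exP : exchange M phi.

Lemma chamber_order : order P (@fle P).
Proof.
split.
- move=> F; have [x [r [rM ->]]] := ch_surj chP F; exact: chamber_le.
- move=> F G H.
  have [x [r [rM ->]]] := ch_surj chP F.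
  have [y [s [sM ->]]] := ch_surj chP G.
  have [z [t [tM ->]]] := ch_surj chP H.
  move=> l1 l2; have rs := chamber_le_rank rM sM l1.
  have st := chamber_le_rank sM tM l2.
  have [u u1 u2] := chamber_le_common rM sM l1.
  have [v v1 v2] := chamber_le_common sM tM l2.
  have [w [w1 w2]] := ex_mix exP sM (etrans u2 (esym v1)).
  rewrite -u1 -v2 -w1 // -w2 //; apply: chamber_le => //; exact: leq_trans st.
- move=> F G.
  have [x [r [rM ->]]] := ch_surj chP F.
  have [y [s [sM ->]]] := ch_surj chP G.
  move=> l1 l2; have e : r = s.
    by apply/eqP; rewrite eqn_leq (chamber_le_rank rM sM l1)
      (chamber_le_rank sM rM l2).
  by rewrite e in l1 *; apply: chamber_le_eq.
Qed.

Lemma exchange_between x y u t v : t <= v -> v <= M ->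
  phi u t = phi x t -> phi u v = phi y v ->
  exists z, [/\ forall q, q <= t -> phi z q = phi x q,
    forall q, v <= q -> q <= M -> phi z q = phi y q,
    phi z t = phi u t & phi z v = phi u v].
Proof.
move=> tv vM e1 e2; have tM := leq_trans tv vM.
have [z [z1 z2]] := ex_mix exP tM (esym e1).
have e3 : phi z v = phi y v by rewrite z2.
have [w [w1 w2]] := ex_mix exP vM e3.
exists w; split=> [q qt|||]; last 3 first.
- exact: w2.
- by rewrite w1 // z2.
- by rewrite w2.
by rewrite w1 ?z1 //; lia.
Qed.

(** A chain has at most one face of each rank; going up through the ranks,
    exchange at the highest face met so far appends the next one. *)
Lemma chain_in_chamber (C : set P) (x0 : X) :
  chain C -> exists x, C `<=` flag_of M phi x.
Proof.
move=> chC.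
suff: forall m, exists x r, [/\ r <= m, r <= M, r = 0 \/ C (phi x r) &
    forall y s, s <= M -> s <= m -> C (phi y s) ->
      s <= r /\ phi y s = phi x s].
  move=> /(_ M)[x [r [_ _ _ h]]]; exists x => F CF.
  have [y [s [sM e]]] := ch_surj chP F; rewrite e in CF *.
  by exists s => //; have [] := h y s sM sM CF.
elim=> [|m [x [r [rm rM Cr h]]]].
  exists x0, 0; split=> //; first by left.
  by move=> y s sM; rewrite leqn0 => /eqP -> _; split=> //; apply: (ex_bot exP).
have [[y [mM Cy]]|no] := pselect (exists y, m.+1 <= M /\ C (phi y m.+1)); last first.
  exists x, r; split=> //; first exact: leqW.
  move=> y s sM sm Cs; have [es|{}sm] : s = m.+1 \/ s <= m by lia.
    by case: no; exists y; rewrite -es.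
  exact: h.
have [u u1 u2] : exists2 u, phi u r = phi x r & phi u m.+1 = phi y m.+1.
  case: Cr => [->|Cr]; first by exists y => //; apply: (ex_bot exP).
  case: (chC _ _ Cr Cy) => [|/(chamber_le_rank mM rM)]; last by lia.
  exact: chamber_le_common.
have [z [z1 z2]] := ex_mix exP rM (esym u1).
exists z, m.+1; split=> //; first by right; rewrite z2 ?u2 //; lia.
move=> v s sM sm Cs; have [es|{}sm] : s = m.+1 \/ s <= m by lia.
  rewrite es in sM Cs *; split; first by []; rewrite z2 ?u2 //; last by lia.
  case: (chC _ _ Cs Cy) => /(chamber_le_eq mM) //.
have [sr ->] := h v s sM sm Cs; split; [lia|by rewrite z1].
Qed.

Lemma flag_of_sub x y : flag_of M phi x `<=` flag_of M phi y ->
  forall r, r <= M -> phi x r = phi y r.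
Proof.
move=> sub r rM; have [|s sM e] := sub (phi x r); first by exists r.
by rewrite e (chamber_rank_inj rM sM e).
Qed.

Lemma flag_of_eq x y : (forall r, r <= M -> phi x r = phi y r) ->
  flag_of M phi x = flag_of M phi y.
Proof.
move=> e; apply/seteqP; split=> _ [r rM ->]; exists r => //; [|symmetry]; exact: e.
Qed.

Lemma flag_of_flag x : flag (flag_of M phi x).
Proof.
split=> [|D chD sub]; first exact: flag_of_chain.
have [y subD] := chain_in_chamber x chD.
apply/seteqP; split=> //; rewrite (flag_of_eq (flag_of_sub (subset_trans sub subD))).
exact: subD.
Qed.

Lemma flagP (x0 : X) (C : set P) : flag C -> exists x, C = flag_of M phi x.
Proof.
move=> [chC maxC]; have [x sub] := chain_in_chamber x0 chC.
by exists x; rewrite (maxC _ (@flag_of_chain x) sub).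
Qed.

Lemma flag_card (x0 : X) (C : set P) : flag C -> (C #= `I_M.+1)%card.
Proof.
move=> /(flagP x0)[x ->].
have -> : flag_of M phi x = phi x @` `I_M.+1.
  apply/seteqP; split=> [_ [r rM ->]|_ [r rM <-]]; first by exists r.
  by exists r.
apply: inj_card_eq => r s; rewrite !inE /= => rM sM.
exact: chamber_rank_inj.
Qed.

Lemma adjacent_at_flag x y r : r <= M -> adjacent_at M phi r x y ->
  flag_adjacent (flag_of M phi x) (flag_of M phi y).
Proof.
move=> rM adj.
have diff u v : adjacent_at M phi r u v ->
    flag_of M phi u `\` flag_of M phi v = [set phi u r].
  move=> huv; apply/seteqP; split=> [_ [[s sM ->] h]|_ ->].
    have [-> //|sr] := pselect (s = r).
    by case: h; exists s => //; apply/(huv _ sM).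
  split; first by exists r.
  move=> [s sM e]; have es := chamber_rank_inj rM sM e.
  by rewrite -es in e; case: (huv _ rM) => /(_ e).
split; [exact: flag_of_flag|exact: flag_of_flag| |].
  by exists (phi x r); apply: diff.
exists (phi y r); apply: diff => s sM; rewrite -(adj s sM); split; exact: esym.
Qed.

Lemma chamber_bot_least x : is_least (phi x 0).
Proof.
move=> F; have [y [r [rM ->]]] := ch_surj chP F.
by rewrite (ex_bot exP x y); apply: chamber_le.
Qed.

Lemma chamber_top_greatest x : is_greatest (phi x M).
Proof.
move=> F; have [y [r [rM ->]]] := ch_surj chP F.
by rewrite (ex_top exP x y); apply: chamber_le.
Qed.

End Flags.

(** * Sections *)

Section Sections.
Variables (P : ranked) (M : nat) (X : Type) (phi : X -> nat -> P).
Hypotheses (chP : chambering M phi) (exP : exchange M phi).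
Variables (x0 : X) (i k : nat).
Hypotheses (ik : i <= k) (kM : k <= M).

(** The chambers of the section between the faces of [x0] at positions [i] and
    [k]: freezing also the faces outside the section makes two of them
    adjacent in the section exactly when they are adjacent in the poset. *)
Definition section_chamber : Type := {x : X | agree_off M phi i k x x0}.

Lemma section_face_proof (x : X) s : agree_off M phi i k x x0 -> i <= s <= k ->
  fle (phi x0 i) (phi x s) /\ fle (phi x s) (phi x0 k).
Proof.
move=> hx /andP[is_ sk].
rewrite -(hx i) -?(hx k); [|lia|by right|lia|by left].
by split; apply: (chamber_le chP) => //; apply: leq_trans kM.
Qed.

Lemma section_pos r : i <= minn (i + r) k <= k. Proof. by lia. Qed.

Definition section_phi (x : section_chamber) (r : nat) :
    section (phi x0 i) (phi x0 k) :=
  exist _ (phi (sval x) (minn (i + r) k))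
    (section_face_proof (svalP x) (section_pos r)).

Lemma section_phiE (x : section_chamber) r :
  i + r <= k -> sval (section_phi x r) = phi (sval x) (i + r).
Proof. by move=> h; rewrite /= (minn_idPl h). Qed.

Lemma section_inj (F G : section (phi x0 i) (phi x0 k)) :
  sval F = sval G -> F = G.
Proof. by case: F G => [F pF] [G pG] /= e; apply: eq_exist. Qed.

Lemma section_agree (x : section_chamber) s : s <= M -> s <= i \/ k <= s ->
  phi (sval x) s = phi x0 s.
Proof. by move=> sM h; apply: (svalP x). Qed.

(** Exchange at both ends of the section replaces the part of a chamber outside
    it by that of [x0]. *)
Lemma section_chamber_ex (x : X) : phi x i = phi x0 i -> phi x k = phi x0 k ->
  exists y : section_chamber,
    forall s, i <= s <= k -> phi (sval y) s = phi x s.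
Proof.
move=> ei ek; have iM : i <= M by lia.
have [y [y1 y2]] := ex_mix exP iM (esym ei).
have yk : phi y k = phi x0 k by rewrite y2.
have [z [z1 z2]] := ex_mix exP kM yk.
have hz : agree_off M phi i k z x0.
  move=> s sM [si|ks]; last by rewrite z2.
  by rewrite z1 ?y1 //; lia.
exists (exist _ z hz) => s /andP[is_ sk] /=.
by rewrite z1 // y2 //; lia.
Qed.

Lemma section_face_ex (F : P) :
  fle (phi x0 i) F -> fle F (phi x0 k) ->
  exists x r, [/\ i <= r <= k, F = phi x r, phi x i = phi x0 i
    & phi x k = phi x0 k].
Proof.
have [y [s [sM ->]]] := ch_surj chP F => l1 l2.
have iM : i <= M by lia.
have is_ := chamber_le_rank chP iM sM l1.
have sk := chamber_le_rank chP sM kM l2.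
have [u u1 u2] := chamber_le_common chP iM sM l1.
have [v v1 v2] := chamber_le_common chP sM kM l2.
have [z [z1 z2]] := ex_mix exP sM (etrans u2 (esym v1)).
exists z, s; split; [lia|by rewrite z1|by rewrite z1|by rewrite z2].
Qed.

Lemma section_chambering : chambering (k - i) section_phi.
Proof.
have surj (F : section (phi x0 i) (phi x0 k)) :
    exists x r, r <= k - i /\ F = section_phi x r.
  case: F => F [l1 l2]; have [x [r [/andP[ir rk_] e ei ek]]] := section_face_ex l1 l2.
  have [y hy] := section_chamber_ex ei ek.
  exists y, (r - i); split; first by lia.
  apply: section_inj; rewrite section_phiE; last by lia.
  by rewrite /= e -hy; [congr (phi _ _); lia|lia].
split=> // [x r rk_|F G].
  change (rk (sval (section_phi x r)) - rk (phi x0 i) - 1 = r%:Z - 1)%R.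
  rewrite section_phiE; last by lia.
  by rewrite !(ch_rk chP) //; lia.
split=> [|[x [r [s [rs sk -> ->]]]]]; last first.
  change (fle (sval (section_phi x r)) (sval (section_phi x s))).
  rewrite !section_phiE; try lia.
  by apply: (chamber_le chP); lia.
have [x [r [rk_ ->]]] := surj F; have [y [s [sk ->]]] := surj G.
change (fle (sval (section_phi x r)) (sval (section_phi y s)) ->
  exists z t u, [/\ t <= u, u <= k - i, section_phi x r = section_phi z t
    & section_phi y s = section_phi z u]).
rewrite !section_phiE; try lia.
move=> l; have rM : i + r <= M by lia.
have sM : i + s <= M by lia.
have rs := chamber_le_rank chP rM sM l.
have [u u1 u2] := chamber_le_common chP rM sM l.
have tv : i + r <= i + s by lia.
have [z [z1 z2 z3 z4]] := exchange_between exP tv sM u1 u2.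
have {}z1 : phi z i = phi x0 i by rewrite z1 ?section_agree //; lia.
have {}z2 : phi z k = phi x0 k by rewrite z2 ?section_agree //; lia.
have [w hw] := section_chamber_ex z1 z2.
exists w, r, s; split=> //; try lia.
  by apply: section_inj; rewrite !section_phiE ?hw ?z3 ?u1 //; lia.
by apply: section_inj; rewrite !section_phiE ?hw ?z4 ?u2 //; lia.
Qed.

Lemma section_exchange : exchange (k - i) section_phi.
Proof.
split=> [x y|x y|x y r rk_ /(congr1 sval)].
- apply: section_inj; rewrite !section_phiE; try lia.
  by rewrite !section_agree //; lia.
- apply: section_inj; rewrite !section_phiE; try lia.
  by rewrite !section_agree //; lia.
rewrite !section_phiE; try lia.
move=> e; have [|z [z1 z2]] := ex_mix exP _ e; first by lia.
have hz : agree_off M phi i k z x0.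
  move=> s sM [si|ks].
    by rewrite z1 ?section_agree //; [left|lia].
  by rewrite z2 ?section_agree //; [right|lia].
exists (exist _ z hz); split=> [s sr|s rs sk].
  by apply: section_inj; rewrite !section_phiE /= ?z1 //; lia.
by apply: section_inj; rewrite !section_phiE /= ?z2 //; lia.
Qed.

Lemma section_adjacent_at r (x y : section_chamber) : i < r < k ->
  adjacent_at M phi r (sval x) (sval y) ->
  adjacent_at (k - i) section_phi (r - i) x y.
Proof.
move=> ir adj s sk; have sM : i + s <= M by lia.
have := adj _ sM; rewrite -!section_phiE; try lia.
move=> [h1 h2]; split=> [e|h]; first by have := h1 (congr1 sval e); lia.
by apply: section_inj; apply: h2; lia.
Qed.

(** Adjacent chambers give adjacent flags, so a path of chambers whose faces
    change only inside the section is a path of flags of the section. *)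
Lemma section_connected :
  (forall x y, agree_off M phi i k x y -> chamber_path M phi i k x y) ->
  flag_connected (section (phi x0 i) (phi x0 k)).
Proof.
move=> conn C D fC fD.
have hx0 : agree_off M phi i k x0 x0 by [].
have y0 : section_chamber by exists x0.
have [x ->] := flagP section_chambering section_exchange y0 fC.
have [y ->] := flagP section_chambering section_exchange y0 fD.
have xy : agree_off M phi i k (sval x) (sval y).
  by move=> s sM h; rewrite !section_agree.
have := conn _ _ xy; move: (svalP y); case: x y {xy} => [x hx] [y hy] /= _ path.
suff: forall (hx : agree_off M phi i k x x0),
    exists hy : agree_off M phi i k y x0,
    clos_refl_trans _ (@flag_adjacent _)
      (flag_of (k - i) section_phi (exist _ x hx))
      (flag_of (k - i) section_phi (exist _ y hy)).
  by move=> /(_ hx)[hy']; rewrite (Prop_irrelevance hy' hy).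
elim: path => {x y fC fD C D hx hy} [x y [r [ir adj]] hx|x hx|x y z _ IH1 _ IH2 hx].
- have hy : agree_off M phi i k y x0.
    move=> s sM h; rewrite -(hx s sM h); symmetry; apply/(adj s sM).
    by move=> e; lia.
  exists hy; apply: rt_step.
  apply: (@adjacent_at_flag _ _ _ _ section_chambering section_exchange _ _ (r - i)); first by lia.
  exact: section_adjacent_at.
- by exists hx; apply: rt_refl.
- have [hy p1] := IH1 hx; have [hz p2] := IH2 hy.
  by exists hz; apply: rt_trans p1 p2.
Qed.

(** An automorphism that maps a chamber through both ends of the section to
    another one fixes these ends, and so restricts to the section. *)
Lemma section_regular :
  (forall x y, phi x i = phi y i -> phi x k = phi y k ->
     exists2 f : P -> P, is_iso f &
       forall s, i <= s <= k -> f (phi x s) = phi y s) ->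
  is_regular (section (phi x0 i) (phi x0 k)).
Proof.
move=> tr C D fC fD.
have y0 : section_chamber by exists x0.
have [x ->] := flagP section_chambering section_exchange y0 fC.
have [y ->] := flagP section_chambering section_exchange y0 fD.
have [f [bf lf] fxy] : exists2 f : P -> P, is_iso f &
       forall s, i <= s <= k -> f (phi (sval x) s) = phi (sval y) s.
  by apply: tr; rewrite !section_agree //; lia.
have fi : f (phi x0 i) = phi x0 i.
  by rewrite -{1}(@section_agree x) ?fxy ?section_agree //; lia.
have fk : f (phi x0 k) = phi x0 k.
  by rewrite -{1}(@section_agree x) ?fxy ?section_agree //; lia.
have [g fg gf] := bf.
have gi : g (phi x0 i) = phi x0 i by rewrite -{1}fi fg.
have gk : g (phi x0 k) = phi x0 k by rewrite -{1}fk fg.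
have pf (F : section (phi x0 i) (phi x0 k)) :
    fle (phi x0 i) (f (sval F)) /\ fle (f (sval F)) (phi x0 k).
  by case: F => F [l1 l2] /=; rewrite -fi -fk; split; apply: (proj1 (lf _ _)).
have pg (F : section (phi x0 i) (phi x0 k)) :
    fle (phi x0 i) (g (sval F)) /\ fle (g (sval F)) (phi x0 k).
  by case: F => F [l1 l2] /=; split; apply: (proj2 (lf _ _)); rewrite gf ?fi ?fk.
exists (fun F => exist _ (f (sval F)) (pf F)).
  split; last by move=> F G; exact: lf.
  exists (fun F => exist _ (g (sval F)) (pg F)) => F; apply: section_inj => /=.
    by rewrite fg.
  by rewrite gf.
apply/seteqP; split=> [_ [_ [r rk_ ->] <-]|_ [r rk_ ->]].
  by exists r => //; apply: section_inj; apply: fxy (section_pos r).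
exists (section_phi x r); first by exists r.
by apply: section_inj; apply: fxy (section_pos r).
Qed.

End Sections.

(** * Chambers give polytopes *)

(** The first two fields say that a flag has exactly one neighbour in each
    proper rank.  The third is connectedness in a form that applies to all
    sections at once. *)
Record thin_connected (P : ranked) (M : nat) (X : Type) (phi : X -> nat -> P) :
    Prop := {
  adj_ex : forall x r, 0 < r < M -> exists y, adjacent_at M phi r x y;
  adj_uniq : forall x y z r, 0 < r < M ->
    adjacent_at M phi r x y -> adjacent_at M phi r x z -> phi y r = phi z r;
  conn : forall x y i k, i <= k -> k <= M ->
    agree_off M phi i k x y -> chamber_path M phi i k x y }.

(** Sections are connected by [section_connected]; in the diamond condition, the
    two middle faces are those of a chamber and of its neighbour, since by
    exchange any middle face belongs to a chamber that agrees with the given one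
    in all other ranks. *)
Theorem chambers_polytope (P : ranked) (n : nat) (X : Type)
    (phi : X -> nat -> P) (x0 : X) :
  chambering n.+1 phi -> exchange n.+1 phi -> thin_connected n.+1 phi ->
  is_polytope n P.
Proof.
move=> chP exP tc; split.
- exact: chamber_order chP exP.
- move=> F G; have [x [r [rM ->]]] := ch_surj chP F.
  have [y [s [sM ->]]] := ch_surj chP G => -[l ne].
  have rs := chamber_le_rank chP rM sM l.
  have [e|{}rs] : r = s \/ r < s by lia.
    by rewrite e in l ne *; case: ne; apply: (chamber_le_eq chP sM l).
  by rewrite !(ch_rk chP) //; lia.
- apply/seteqP; split=> [_ [F _ <-]|j /= /andP[j1 j2]].
    by have [x [r [rM ->]]] := ch_surj chP F; rewrite (ch_rk chP) //=; lia.
  exists (phi x0 (absz (j + 1)%R)) => //.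
  by rewrite (ch_rk chP) //; lia.
- exists (phi x0 0); split; first exact: (chamber_bot_least chP exP).
  move=> F lF; have := chamber_bot_least chP exP x0 F.
  by have [_ _ anti] := chamber_order chP exP; move=> l; apply: anti.
- exists (phi x0 n.+1); split; first exact: (chamber_top_greatest chP exP).
  move=> F gF; have := chamber_top_greatest chP exP x0 F.
  by have [_ _ anti] := chamber_order chP exP; move=> l; apply: anti.
- by move=> C fC; apply: (flag_card chP exP x0 fC).
- move=> j F G; have [x' [r [rM ->]]] := ch_surj chP F.
  have [y' [s [sM ->]]] := ch_surj chP G.
  rewrite !(ch_rk chP) // => -[l _] e1 e2.
  have [x ex ey] := chamber_le_common chP rM sM l.
  have es : s = r.+2 by lia.
  have ej : j = (r.+1%:Z - 1)%R by lia.
  rewrite {}es {}ej in ey sM l *; rewrite -{}ex -{}ey {x' y' l e1 e2}.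
  have rr : 0 < r.+1 < n.+1 by lia.
  have [y adj] := adj_ex tc x rr.
  have ne : phi x r.+1 <> phi y r.+1.
    by move=> /(adj _ (ltnW sM)).
  have -> : [set H | [/\ rk H = (r.+1%:Z - 1)%R, flt (phi x r) H
      & flt H (phi x r.+2)]] = (fun b : nat => if b == 0 then phi x r.+1 else phi y r.+1) @` `I_2.
    apply/seteqP; split=> [H|_ [b _ <-]] /=; last first.
      have h z : phi z r = phi x r -> phi z r.+2 = phi x r.+2 ->
          [/\ rk (phi z r.+1) = (r.+1%:Z - 1)%R, flt (phi x r) (phi z r.+1)
            & flt (phi z r.+1) (phi x r.+2)].
        move=> <- <-; split; first by rewrite (ch_rk chP) //; lia.
          split; first by apply: (chamber_le chP); lia.
          by move/(chamber_rank_inj chP) => h; have := h rM (ltnW sM); lia.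
        split; first by apply: (chamber_le chP); lia.
        by move/(chamber_rank_inj chP) => h; have := h (ltnW sM) sM; lia.
      by case: (b == 0); apply: h => //; symmetry; apply/adj => //; lia.
    move=> [rkH [l1 _] [l2 _]].
    have [_ [z eH]] := chamber_rank_ex chP rkH; rewrite {}eH {rkH H} in l1 l2 *.
    have [u u1 u2] := chamber_le_common chP rM (ltnW sM) l1.
    have [v v1 v2] := chamber_le_common chP (ltnW sM) sM l2.
    have [w [w1 w2]] := ex_mix exP (ltnW sM) (etrans u2 (esym v1)).
    have [w' [w1' w2']] := ex_mix exP rM (esym (etrans (w1 _ (leqnSn _)) u1)).
    have [t [t1 t2]] := ex_mix exP sM (etrans (w2' _ (leqW (leqnSn _)) sM)
      (etrans (w2 _ (leqnSn _) sM) v2)).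
    have tr : phi t r.+1 = phi z r.+1.
      by rewrite t1 // w2' // ?w1 ?u2 //; lia.
    rewrite -tr; have [e|e] := pselect (phi x r.+1 = phi t r.+1).
      by exists 0.
    exists 1 => //=; apply: (adj_uniq tc rr adj) => q qM.
    split=> [eq er|qr]; first by rewrite er in eq.
    have [qr'|qr'] : q <= r \/ r.+2 <= q by lia.
      by rewrite t1 ?w1' //; lia.
    by rewrite t2.
  apply: inj_card_eq => b c; rewrite !inE /=.
  by case: b => [|[|b]] //; case: c => [|[|c]] //= _ _ e; case: ne.
- move=> F G; have [x' [r [rM ->]]] := ch_surj chP F.
  have [y' [s [sM ->]]] := ch_surj chP G => l.
  have rs := chamber_le_rank chP rM sM l.
  have [x <- <-] := chamber_le_common chP rM sM l.
  by apply: (section_connected chP exP) => // y z; apply: (conn tc).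
Qed.

(** * Isomorphisms from maps of chambers *)

Lemma is_iso_isomorphic_sym (P Q : ranked) (f : P -> Q) :
  is_iso f -> isomorphic Q P.
Proof.
move=> [[g fg gf] lf]; exists g; split; first by exists f.
by move=> F G; split=> l; [apply: (proj2 (lf _ _))|have := proj1 (lf _ _) l];
  rewrite !gf.
Qed.

(** A map [h] from the chambers of [Q] to those of [P] through the two ends of
    a section induces an isomorphism onto the section as soon as it reaches
    all these chambers, up to faces outside the section, and reflects and
    preserves the sharing of faces: the orders on both sides are determined by
    which faces lie in a common chamber. *)
Lemma chamber_map_iso (P Q : ranked) (M N : nat) (X Y : Type)
    (phi : X -> nat -> P) (psi : Y -> nat -> Q) (x0 : X) (i : nat)
    (h : Y -> X) :
  chambering M phi -> exchange M phi -> chambering N psi -> i + N <= M ->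
  (forall y, phi (h y) i = phi x0 i) ->
  (forall y, phi (h y) (i + N) = phi x0 (i + N)) ->
  (forall x, phi x i = phi x0 i -> phi x (i + N) = phi x0 (i + N) ->
     exists y, forall r, r <= N -> phi x (i + r) = phi (h y) (i + r)) ->
  (forall y z r, r <= N ->
     (phi (h y) (i + r) = phi (h z) (i + r) <-> psi y r = psi z r)) ->
  exists f : Q -> section (phi x0 i) (phi x0 (i + N)), is_iso f /\
    forall y r, r <= N -> sval (f (psi y r)) = phi (h y) (i + r).
Proof.
move=> chP exP chQ iNM hi hk hsurj hinj.
have pf y r : r <= N -> fle (phi x0 i) (phi (h y) (i + r)) /\
    fle (phi (h y) (i + r)) (phi x0 (i + N)).
  by move=> rN; rewrite -(hi y) -(hk y); split; apply: (chamber_le chP); lia.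
have /choice[f hf] : forall F : Q,
    exists H : section (phi x0 i) (phi x0 (i + N)),
    forall y r, r <= N -> F = psi y r -> sval H = phi (h y) (i + r).
  move=> F; have [y [r [rN ->]]] := ch_surj chQ F.
  exists (exist (fun H => fle (phi x0 i) H /\ fle H (phi x0 (i + N))) _ (pf y r rN)) => z s sN e /=.
  have rs := chamber_rank_inj chQ rN sN e; rewrite -rs in sN e *.
  exact/hinj.
have {}hf y r : r <= N -> sval (f (psi y r)) = phi (h y) (i + r).
  by move=> rN; apply: hf.
exists f; split=> //.
have fsurj H : exists F, f F = H.
  case: H => H [l1 l2].
  have [||x [r [ir e e1 e2]]] := section_face_ex chP exP _ _ l1 l2; try lia.
  have [y hy] := hsurj x e1 e2; exists (psi y (r - i)).
  apply: section_inj; rewrite hf /=; last by lia.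
  by rewrite -hy ?e; [congr (phi _ _); lia|lia].
have finj F G : f F = f G -> F = G.
  have [y [r [rN ->]]] := ch_surj chQ F; have [z [s [sN ->]]] := ch_surj chQ G.
  move=> /(congr1 sval); rewrite !hf // => e.
  have rs : r = s.
    have iNr : i + r <= M by lia.
    have iNs : i + s <= M by lia.
    by have := chamber_rank_inj chP iNr iNs e; lia.
  by rewrite -rs in sN e *; apply/hinj.
have /choice[g hg] := fsurj.
split; first by exists g => // F; apply: finj.
move=> F G; split=> [/(ch_le chQ)[y [r [s [rs sN -> ->]]]]|].
  change (fle (sval (f (psi y r))) (sval (f (psi y s)))).
  by rewrite !hf //; [apply: (chamber_le chP); lia|lia].
have [y [r [rN ->]]] := ch_surj chQ F; have [z [s [sN ->]]] := ch_surj chQ G.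
change (fle (sval (f (psi y r))) (sval (f (psi z s))) ->
  fle (psi y r) (psi z s)).
rewrite !hf // => l.
have rM : i + r <= M by lia.
have sM : i + s <= M by lia.
have rs := chamber_le_rank chP rM sM l.
have [u u1 u2] := chamber_le_common chP rM sM l.
have tv : i + r <= i + s by lia.
have [v [v1 v2 v3 v4]] := exchange_between exP tv sM u1 u2.
have {}v1 : phi v i = phi x0 i by rewrite v1 ?hi //; lia.
have {}v2 : phi v (i + N) = phi x0 (i + N) by rewrite v2 ?hk //; lia.
have [w hw] := hsurj v v1 v2.
have -> : psi y r = psi w r by apply/hinj; rewrite // -hw // v3 u1.
have -> : psi z s = psi w s by apply/hinj; rewrite // -hw // v4 u2.
by apply: (chamber_le chQ); lia.
Qed.

(** * Subgroups given by generators *)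

Section Subgroups.
Variable gT : groupType.
Implicit Types (H Gamma : set gT) (x y z : gT) (g : nat -> gT) (I J : set nat).

Lemma subgroup1 H : is_subgroup H -> H 1%g.
Proof. by case. Qed.

Lemma subgroupV H x : is_subgroup H -> H x -> H (x^-1)%g.
Proof. by move=> [H1 HM] Hx; have := HM _ _ H1 Hx; rewrite mul1g. Qed.

Lemma subgroupM H x y : is_subgroup H -> H x -> H y -> H (x * y)%g.
Proof.
move=> sH Hx Hy; have := sH.2 _ _ Hx (subgroupV sH Hy).
by rewrite invgK.
Qed.

Lemma is_subgroupP H : H 1%g -> (forall x y, H x -> H y -> H (x * y)%g) ->
  (forall x, H x -> H (x^-1)%g) -> is_subgroup H.
Proof. by move=> H1 HM HV; split=> // x y Hx Hy; apply: HM => //; apply: HV. Qed.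

Lemma rcosetP H x z : is_subgroup H -> rcoset H x z <-> H (z * x^-1)%g.
Proof.
move=> sH; split=> [[h Hh <-]|Hz]; first by rewrite mulgK.
by exists (z * x^-1)%g => //; rewrite mulgVK.
Qed.

Lemma rcoset_refl H x : is_subgroup H -> rcoset H x x.
Proof. by move=> sH; apply/rcosetP => //; rewrite mulgV; apply: subgroup1. Qed.

(** Facets of both types have the same rank, so cosets of different subgroups
    have to be compared as well: a coset determines its subgroup. *)
Lemma rcoset_eq H H' x y : is_subgroup H -> is_subgroup H' ->
  rcoset H x = rcoset H' y <-> H = H' /\ H (x * y^-1)%g.
Proof.
move=> sH sH'; split=> [e|[<- Hxy]]; last first.
  apply/seteqP; split=> z /(rcosetP _ _ sH) h; apply/(rcosetP _ _ sH).
    by have := subgroupM sH h Hxy; rewrite mulgA mulgVK.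
  by have := subgroupM sH h (subgroupV sH Hxy); rewrite invgM invgK mulgA mulgVK.
have H'xy : H' (x * y^-1)%g by apply/rcosetP; rewrite // -e; apply: rcoset_refl.
suff eH : H = H' by split=> //; rewrite eH.
apply/seteqP; split=> h Hh.
  have : rcoset H' y (h * x)%g by rewrite -e; exists h.
  move/(rcosetP _ _ sH') => h'.
  have := subgroupM sH' h' (subgroupV sH' H'xy).
  by rewrite invgM invgK mulgA mulgVK mulgK.
have : rcoset H x (h * x)%g.
  rewrite e; apply/rcosetP => //; rewrite -mulgA; exact: subgroupM.
by move/(rcosetP _ _ sH); rewrite mulgK.
Qed.

Lemma rcosetM H x y : rcoset (rcoset H x) y = rcoset H (x * y)%g.
Proof.
apply/seteqP; split=> [_ [_ [h Hh <-] <-]|_ [h Hh <-]].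
  by exists h; rewrite ?mulgA.
by exists (h * x)%g; [exists h|rewrite mulgA].
Qed.

Lemma gen_by_subgroup g I : is_subgroup (gen_by g I).
Proof.
split; first exact: gen_by1.
by move=> x y hx hy H [sH sub]; apply: sH.2; [apply: hx|apply: hy].
Qed.

Lemma gen_by_gen g I i : I i -> gen_by g I (g i).
Proof. by move=> Ii H [_ sub]; apply: sub; exists i. Qed.

Lemma gen_by_min g I H : is_subgroup H -> (forall i, I i -> H (g i)) ->
  gen_by g I `<=` H.
Proof. by move=> sH h x; apply; split=> // _ [i Ii <-]; apply: h. Qed.

Lemma gen_by_sub g I J : I `<=` J -> gen_by g I `<=` gen_by g J.
Proof.
move=> IJ; apply: gen_by_min; first exact: gen_by_subgroup.
by move=> i Ii; apply: gen_by_gen; apply: IJ.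
Qed.

Lemma gen_by_reindex g g' I J (f : nat -> nat) : f @` I = J ->
  (forall i, I i -> g (f i) = g' i) -> gen_by g' I = gen_by g J.
Proof.
move=> <- e; rewrite /gen_by; congr smallest; apply/seteqP; split=> [_ [i Ii <-]|].
  by exists (f i); [exists i|apply: e].
by move=> _ [_ [i Ii <-] <-]; exists i; rewrite ?e.
Qed.

Lemma gen_by_set0 g : gen_by g set0 = [set 1%g].
Proof.
apply/seteqP; split=> [|_ ->]; last exact: gen_by1.
apply: gen_by_min => //; split=> // _ _ -> ->; by rewrite mulgV.
Qed.

Lemma gen_by_commute g I J :
  (forall i j, I i -> J j -> commute (g i) (g j)) ->
  forall u v, gen_by g I u -> gen_by g J v -> commute u v.
Proof.
move=> comm u v hu.
have cent z : is_subgroup [set y | commute y z].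
  apply: is_subgroupP => [|y y' h h'|y h] /=; first exact: commute_sym (commute1 _).
    by apply: commute_sym; apply: commuteM; apply: commute_sym.
  by apply: commute_sym; apply: commuteV; apply: commute_sym.
move=> hv; apply: commute_sym; apply: (gen_by_min (cent u) _ hv) => j Jj.
apply: commute_sym.
by apply: (gen_by_min (cent (g j)) _ hu) => i Ii; apply: comm.
Qed.

(** When the generators in [I] commute with those in [J], so do the subgroups,
    whose product is therefore a subgroup. *)
Lemma gen_by_commuteU g I J :
  (forall i j, I i -> J j -> commute (g i) (g j)) ->
  forall x, gen_by g (I `|` J) x ->
  exists u v, [/\ gen_by g I u, gen_by g J v & x = (u * v)%g].
Proof.
move=> comm; have comm2 := gen_by_commute comm.
have sI := gen_by_subgroup g I; have sJ := gen_by_subgroup g J.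
apply: (@gen_by_min g (I `|` J)
  [set x | exists u v, [/\ gen_by g I u, gen_by g J v & x = (u * v)%g]]).
  apply: is_subgroupP.
  - by exists 1%g, 1%g; rewrite mulg1; split=> //; apply: gen_by1.
  - move=> _ _ [u [v [hu hv ->]]] [u' [v' [hu' hv' ->]]].
    exists (u * u')%g, (v * v')%g; split;
      [exact: (subgroupM sI hu hu')|exact: (subgroupM sJ hv hv')|].
    by rewrite -!mulgA; congr (_ * _)%g; rewrite !mulgA (comm2 u' v).
  - move=> _ [u [v [hu hv ->]]]; exists (u^-1)%g, (v^-1)%g.
    split; [exact: (subgroupV sI hu)|exact: (subgroupV sJ hv)|].
    by rewrite (comm2 u v) // invgM.
move=> i [Ii|Ji].
  by exists (g i), 1%g; rewrite mulg1; split=> //; [apply: gen_by_gen|apply: gen_by1].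
by exists 1%g, (g i); rewrite mul1g; split=> //; [apply: gen_by1|apply: gen_by_gen].
Qed.

Lemma involutionV x : involution x -> (x^-1 = x)%g.
Proof. by move=> [_ x2]; rewrite -[LHS]mulg1 -x2 expgS expg1 mulKg. Qed.

Lemma involutionK x y : involution x -> (x * (x * y) = y)%g.
Proof. by move=> [_ x2]; rewrite mulgA -{2}[y]mul1g -x2 expgS expg1. Qed.

Lemma gen_by1_involution g i x : involution (g i) ->
  gen_by g [set i] x -> x = 1%g \/ x = g i.
Proof.
move=> inv; apply: (@gen_by_min g [set i] [set x | x = 1%g \/ x = g i]); last first.
  by move=> _ ->; right.
apply: is_subgroupP; first by left.
  move=> y z [->|->] [->|->]; rewrite ?mulg1 ?mul1g; try (by left); try (by right).
  by left; have := involutionK 1%g inv; rewrite !mulg1.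
by move=> y [->|->]; [left; rewrite invg1|right; apply: involutionV].
Qed.

Section CGroup.
Variables (m : nat) (g : nat -> gT).
Hypothesis Cg : is_C_group m g.

Lemma C_group_setI I J x : I `<=` `I_m -> J `<=` `I_m ->
  gen_by g I x -> gen_by g J x -> gen_by g (I `&` J) x.
Proof. by move=> Im Jm h h'; rewrite -Cg.2. Qed.

Lemma C_group_gen i I : i < m -> I `<=` `I_m -> gen_by g I (g i) -> I i.
Proof.
move=> im Im h.
have im' : [set i] `<=` `I_m by move=> _ ->.
have [//|nI] := pselect (I i).
have := C_group_setI im' Im (@gen_by_gen g [set i] i (erefl i)) h.
have -> : [set i] `&` I = set0.
  by apply/seteqP; split=> // _ [-> /nI].
rewrite gen_by_set0 => e; have [ne _] := Cg.1 _ im; by case: (ne e).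
Qed.

Lemma C_group_inj I J : I `<=` `I_m -> J `<=` `I_m ->
  gen_by g I = gen_by g J -> I = J.
Proof.
move=> Im Jm e; apply/seteqP; split=> i hi.
  by apply: C_group_gen => //; [exact: Im|rewrite -e; apply: gen_by_gen].
by apply: C_group_gen => //; [exact: Jm|rewrite e; apply: gen_by_gen].
Qed.

Lemma C_group_bigcap (N : nat) (Q : set nat) (T : nat -> set nat) x :
  (forall s, s < N -> Q s -> T s `<=` `I_m) -> gen_by g `I_m x ->
  (forall s, s < N -> Q s -> gen_by g (T s) x) ->
  gen_by g [set i | i < m /\ forall s, s < N -> Q s -> T s i] x.
Proof.
elim: N => [|N IH] TI hx hT.
  by apply: gen_by_sub hx => i /= im; split.
have {}IH : gen_by g [set i | i < m /\ forall s, s < N -> Q s -> T s i] x.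
  by apply: IH => // s sN; [apply: TI|apply: hT]; apply: ltnW.
have [QN|nQ] := pselect (Q N); last first.
  apply: gen_by_sub IH => i [im h]; split=> // s sN Qs.
  by apply: h => //; rewrite ltn_neqAle -ltnS sN andbT; apply: contra_notN nQ => /eqP <-.
have := C_group_setI _ (TI N (leqnn _) QN) IH (hT N (leqnn _) QN).
move=> h; apply: gen_by_sub (h _) => [i [[im h1] h2]|i [] //]; split=> // s sN Qs.
have [->//|sN'] : s = N \/ s < N by lia.
exact: h1.
Qed.

End CGroup.

(** * Coset posets *)

(** [Hs e r] is the subgroup whose cosets are the faces of rank [r - 1] of type
    [e].  Condition [cs_mix] lets faces of different types and ranks be combined;
    in the posets below the type matters in one rank only. *)
Record coset_system (E : Type) (M : nat) (Gamma : set gT)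
    (K : int -> set gT -> Prop) (Hs : E -> nat -> set gT) : Prop := {
  cs_Gamma : is_subgroup Gamma;
  cs_sub : forall e r, r <= M -> is_subgroup (Hs e r);
  cs_type : forall j H, K j H <->
    exists e r, [/\ r <= M, j = (r%:Z - 1)%R & H = Hs e r];
  cs_Gamma_sub : forall e r, r <= M -> Hs e r `<=` Gamma;
  cs_mix : forall e e' r s, r < s -> s <= M ->
    exists e'', Hs e'' r = Hs e r /\ Hs e'' s = Hs e' s }.

Section CosetSystem.
Variables (E : Type) (M : nat) (Gamma : set gT) (K : int -> set gT -> Prop).
Variable Hs : E -> nat -> set gT.
Hypothesis csP : coset_system M Gamma K Hs.

Definition coset_chamber : Type := ({x | Gamma x} * E)%type.

Lemma coset_face_proof (c : coset_chamber) r :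
  is_coset_face Gamma K
    (((minn r M)%:Z - 1)%R, rcoset (Hs c.2 (minn r M)) (sval c.1)).
Proof.
exists (Hs c.2 (minn r M)), (sval c.1); split=> //=; last exact: (svalP c.1).
by apply/(cs_type csP); exists c.2, (minn r M); split=> //; apply: geq_minr.
Qed.

(** Positions beyond [M] repeat the greatest face, which makes the function
    total. *)
Definition coset_phi (c : coset_chamber) (r : nat) : coset_poset Gamma K :=
  exist _ _ (coset_face_proof c r).

Lemma coset_phiE c r : r <= M ->
  sval (coset_phi c r) = ((r%:Z - 1)%R, rcoset (Hs c.2 r) (sval c.1)).
Proof. by move=> rM; rewrite /= (minn_idPl rM). Qed.

Lemma coset_face_inj (F G : coset_poset Gamma K) : sval F = sval G -> F = G.
Proof. by case: F G => F pF [G pG] /= e; apply: eq_exist. Qed.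

Lemma coset_phi_eq c d r : r <= M ->
  coset_phi c r = coset_phi d r <->
  Hs c.2 r = Hs d.2 r /\ Hs c.2 r (sval c.1 * (sval d.1)^-1)%g.
Proof.
move=> rM; have sub := cs_sub csP.
rewrite -rcoset_eq; [|exact: sub|exact: sub]; split=> [/(congr1 sval)|e].
  by rewrite !coset_phiE // => -[].
by apply: coset_face_inj; rewrite !coset_phiE // e.
Qed.

Lemma coset_phi_surj (F : coset_poset Gamma K) e x r : r <= M -> Gamma x ->
  (sval F).1 = (r%:Z - 1)%R -> (sval F).2 = rcoset (Hs e r) x ->
  exists c : coset_chamber, [/\ F = coset_phi c r, sval c.1 = x & c.2 = e].
Proof.
move=> rM Gx e1 e2; exists (exist _ x Gx, e); split=> //.
by apply: coset_face_inj; rewrite coset_phiE // -e1 -e2; case: (sval F).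
Qed.

Lemma coset_chambering : chambering M coset_phi.
Proof.
have surj (F : coset_poset Gamma K) : exists c r, r <= M /\ F = coset_phi c r.
  have [H [x [/(cs_type csP)[e [r [rM ej eH]]] Gx eF]]] := svalP F.
  rewrite eH in eF; have [c [-> _ _]] := coset_phi_surj rM Gx ej eF.
  by exists c, r.
split=> // [c r rM|F G].
  by rewrite /rk /coset_poset coset_phiE.
split=> [|[c [r [s [rs sM -> ->]]]]]; last first.
  rewrite /fle /coset_poset !coset_phiE //=; last exact: leq_trans sM.
  have [->|rs'] : r = s \/ r < s by lia.
    by right.
  left; split; first by lia.
  exists (sval c.1); split; apply: rcoset_refl; apply: (cs_sub csP) => //.
  exact: leq_trans sM.
have [c [r [rM ->]]] := surj F; have [d [s [sM ->]]] := surj G.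
rewrite {1}/fle {1}/coset_poset !coset_phiE //=.
move=> [[rs [z [zc zd]]]|[rs e]]; last first.
  exists c, r, r; split=> //; apply: coset_face_inj.
  by rewrite !coset_phiE // -rs e.
have {}rs : r < s by lia.
have [e [er es]] := cs_mix csP c.2 d.2 rs sM.
have Gz : Gamma z.
  case: zc => h hh <-; apply: subgroupM; first exact: (cs_Gamma csP).
    exact: (cs_Gamma_sub csP rM hh).
  exact: (svalP c.1).
exists (exist _ z Gz, e), r, s; split=> //; [exact: ltnW| |].
  apply/coset_phi_eq => //=; split=> //.
  rewrite -[X in Hs c.2 r X]invgK; apply: subgroupV; first exact: (cs_sub csP).
  by rewrite invgM invgK; apply/rcosetP => //; apply: (cs_sub csP).
apply/coset_phi_eq => //=; split=> //.
rewrite -[X in Hs d.2 s X]invgK; apply: subgroupV; first exact: (cs_sub csP).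
by rewrite invgM invgK; apply/rcosetP => //; apply: (cs_sub csP).
Qed.

(** Right multiplication by [x^-1 y], where the chambers lie over [x] and [y].
    It preserves types, whence the condition on the subgroups. *)
Lemma coset_translation (c d : coset_chamber) :
  exists2 f : coset_poset Gamma K -> coset_poset Gamma K, is_iso f &
    forall r, r <= M -> Hs c.2 r = Hs d.2 r -> f (coset_phi c r) = coset_phi d r.
Proof.
have sG := cs_Gamma csP.
have pf y (Gy : Gamma y) (F : coset_poset Gamma K) :
    is_coset_face Gamma K ((sval F).1, rcoset (sval F).2 y).
  have [H [x [KH Gx eF]]] := svalP F; exists H, (x * y)%g; split=> //=.
    exact: subgroupM.
  by rewrite eF rcosetM.
pose t y (Gy : Gamma y) F : coset_poset Gamma K := exist _ _ (pf y Gy F).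
have tK y y' (Gy : Gamma y) (Gy' : Gamma y') : (y * y' = 1)%g ->
    cancel (t y Gy) (t y' Gy').
  move=> e F; apply: coset_face_inj => /=.
  by rewrite rcosetM e rcoset1; case: (sval F).
pose y := ((sval c.1)^-1 * sval d.1)%g.
have Gy : Gamma y.
  apply: subgroupM => //; last exact: (svalP d.1).
  by apply: subgroupV => //; apply: (svalP c.1).
have GVy : Gamma (y^-1)%g by apply: subgroupV.
exists (t y Gy).
  split; first by exists (t _ GVy); apply: tK; rewrite ?mulgV ?mulVg.
  have mono z (Gz : Gamma z) F G : fle F G -> fle (t z Gz F) (t z Gz G).
    move=> [[lt [u [uF uG]]]|[e1 e2]]; last by right; rewrite /= e1 e2.
    left; split=> //=; exists (u * z)%g; split.
      by exists u.
    by exists u.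
  move=> F G; split; first exact: mono.
  move=> /(mono _ GVy); rewrite !tK ?mulgV //.
move=> r rM e; apply: coset_face_inj; rewrite coset_phiE //.
rewrite -[LHS]/((sval (coset_phi c r)).1, rcoset (sval (coset_phi c r)).2 y).
by rewrite coset_phiE //= rcosetM /y mulVKg e.
Qed.

End CosetSystem.
End Subgroups.

Lemma gen_by_ext (gT : groupType) (g g' : nat -> gT) (I J : set nat) :
  (forall i, I i <-> J i) -> (forall i, I i -> g i = g' i) ->
  gen_by g I = gen_by g' J.
Proof.
move=> IJ e; have <- : I = J by apply/seteqP; split=> i /IJ.
by symmetry; apply: (@gen_by_reindex _ g g' I I id); rewrite ?image_id.
Qed.

(** ** The poset of a string group *)

Section StringPoset.
Variables (gT : groupType) (n : nat) (g : nat -> gT).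

Definition string_index (r : nat) : set nat := [set i | i < n /\ i.+1 <> r].

Definition string_sub (_ : unit) (r : nat) : set gT :=
  gen_by g (string_index r).

Lemma string_coset_system :
  coset_system n.+1 (gen_by g `I_n) (string_type n g) string_sub.
Proof.
have all_r r : r = 0 \/ r = n.+1 -> string_sub tt r = gen_by g `I_n.
  by move=> h; apply: gen_by_ext => // i; rewrite /string_index /=; lia.
have proper j : j < n -> string_sub tt j.+1 = gen_by g (`I_n `\ j).
  move=> jn; apply: gen_by_ext => // i; rewrite /string_index /=.
  by split=> -[h1 h2]; split=> //; lia.
split.
- exact: gen_by_subgroup.
- by move=> e r _; apply: gen_by_subgroup.
- move=> j H; split.
  + case=> [|i ilt|].
    * by exists tt, 0; rewrite all_r; [|left].
    * by exists tt, i.+1; rewrite proper //; split=> //; lia.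
    * by exists tt, n.+1; rewrite all_r; [split=> //; lia|right].
  + move=> [[] [r [rn -> ->]]].
    have [e|[e|e]] : r = 0 \/ r = n.+1 \/ 0 < r < n.+1 by lia.
    * by rewrite e all_r; [exact: string_type_bot|left].
    * rewrite e all_r; last by right.
      have -> : (n.+1%:Z - 1 = n%:Z)%R by lia.
      exact: string_type_top.
    * have [j' ej jn] : exists2 j', r = j'.+1 & j' < n by exists r.-1; lia.
      rewrite ej proper //; have -> : (j'.+1%:Z - 1 = j'%:Z)%R by lia.
      exact: string_type_proper.
- by move=> e r _; apply: gen_by_sub => i [].
- by move=> [] [] r s _ _; exists tt.
Qed.

End StringPoset.

(** ** The poset of a tail-triangle group *)

(** Here too, position [r] stands for rank [r - 1].  Ridges lose both ends of the
    triangle; a facet loses one of them, according to its type [e]: [true] for P,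
    [false] for Q.  Since the type matters only at position [n.+1], this presents
    the poset as if it were that of a string group of rank [n.+1] whose last
    generator exchanges the two types. *)
Definition tt_absent (n : nat) (e : bool) (r i : nat) : bool :=
  [|| (i.+1 == r) && (r < n), (r == n) && (n.-1 <= i)
    | (r == n.+1) && (i == if e then n else n.-1)].

Definition tt_index (n : nat) (e : bool) (r : nat) : set nat :=
  [set i | i < n.+1 /\ ~~ tt_absent n e r i].

Definition tt_sub (gT : groupType) (n : nat) (a : nat -> gT) (b : gT)
    (e : bool) (r : nat) : set gT :=
  gen_by (tt_gens n a b) (tt_index n e r).

Section TailTriangle.
Variables (gT : groupType) (n : nat) (a : nat -> gT) (b : gT) (k : option nat).
Hypothesis hG : tail_triangle_C_group n a b k.
Let n_gt0 : 0 < n := tt_rank hG.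
Let G := tt_gens n a b.
Let H e r := tt_sub n a b e r.

Lemma tt_sub_all e r : r = 0 \/ r = n.+2 -> H e r = tt_group n a b.
Proof.
move=> h; apply: gen_by_ext => // i; rewrite /tt_index /tt_absent /=; lia.
Qed.

Lemma tt_sub_proper e j : j + 2 <= n -> H e j.+1 = gen_by G (`I_n.+1 `\ j).
Proof.
move=> jn; apply: gen_by_ext => // i; rewrite /tt_index /tt_absent /=.
split=> [[h1 h2]|[h1 h2]]; split=> //; last by case: e; lia.
by move=> e'; move: h2; rewrite e'; lia.
Qed.

Lemma tt_sub_ridge e : H e n = gen_by a `I_n.-1.
Proof.
apply: gen_by_ext => i; rewrite /tt_index /tt_absent /tt_gens /=.
  by case: e; lia.
by move=> [h1 h2]; case: eqP => // ?; lia.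
Qed.

Lemma tt_sub_facetP : H true n.+1 = gen_by a `I_n.
Proof.
apply: gen_by_ext => i; rewrite /tt_index /tt_absent /tt_gens /=; first by lia.
by move=> [h1 h2]; case: eqP => // ?; lia.
Qed.

Lemma tt_gensQ_gen (I : set nat) : I `<=` `I_n ->
  gen_by (tt_gensQ n a b) I =
  gen_by G ((fun i => if i == n.-1 then n else i) @` I).
Proof.
move=> In; apply: gen_by_reindex => // i /In /= ilt.
rewrite /G /tt_gens /tt_gensQ; case: (i =P n.-1) => [_|ne]; first by rewrite eqxx.
by case: eqP => // ?; lia.
Qed.

Lemma tt_sub_facetQ : H false n.+1 = gen_by (tt_gensQ n a b) `I_n.
Proof.
rewrite tt_gensQ_gen //; congr gen_by; apply/seteqP.
rewrite /tt_index /tt_absent; split=> [i /= [h1 h2]|_ [i /= ilt <-]].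
  have [e|e] : i = n \/ i < n.-1 by lia.
    by exists n.-1; rewrite ?eqxx //=; lia.
  by exists i => /=; [lia|case: eqP => // ?; lia].
by case: (i =P n.-1) => ?; split; lia.
Qed.

Lemma S_coset_system :
  coset_system n.+2 (tt_group n a b) (S_type n a b) H.
Proof.
split.
- exact: gen_by_subgroup.
- by move=> e r _; apply: gen_by_subgroup.
- move=> j K; split.
  + case=> [|i ilt||||].
    * by exists true, 0; rewrite tt_sub_all; [|left].
    * by exists true, i.+1; rewrite tt_sub_proper //; split=> //; lia.
    * by exists true, n; rewrite tt_sub_ridge; split=> //; lia.
    * by exists true, n.+1; rewrite tt_sub_facetP; split=> //; lia.
    * by exists false, n.+1; rewrite tt_sub_facetQ; split=> //; lia.
    * by exists true, n.+2; rewrite tt_sub_all; [split=> //; lia|right].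
  + move=> [e [r [rn -> ->]]].
    have [er|[er|[er|[er|er]]]] : r = 0 \/ r = n.+2 \/ r = n \/ r = n.+1 \/
      0 < r < n by lia.
    * by rewrite er tt_sub_all; [exact: S_type_bot|left].
    * rewrite er tt_sub_all; last by right.
      have -> : (n.+2%:Z - 1 = n%:Z + 1)%R by lia.
      exact: S_type_top.
    * by rewrite er tt_sub_ridge; exact: S_type_ridge.
    * rewrite er; have -> : (n.+1%:Z - 1 = n%:Z)%R by lia.
      case: e; rewrite ?tt_sub_facetP ?tt_sub_facetQ; first exact: S_type_facetP.
      exact: S_type_facetQ.
    * have [j' ej jn] : exists2 j', r = j'.+1 & j' + 2 <= n by exists r.-1; lia.
      rewrite ej tt_sub_proper //; have -> : (j'.+1%:Z - 1 = j'%:Z)%R by lia.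
      exact: S_type_proper.
- by move=> e r _; apply: gen_by_sub => i [].
- move=> e e' r s rs sn; exists (if r == n.+1 then e else e').
  have ind d d' q : q != n.+1 -> H d q = H d' q.
    by move=> qn; apply: gen_by_ext => // i; rewrite /tt_index /tt_absent (negbTE qn).
  case: (r =P n.+1) => [er|ner]; split=> //; apply: ind; lia.
Qed.

(** ** The chambers of the poset of a tail-triangle group *)

Let Cham := coset_chamber bool (tt_group n a b).
Let phi : Cham -> nat -> S_poset n a b := coset_phi S_coset_system.

Lemma S_chambering : chambering n.+2 phi.
Proof. exact: coset_chambering. Qed.

Lemma tt_index_sub e r : tt_index n e r `<=` `I_n.+1.
Proof. by move=> i []. Qed.

Lemma tt_sub_type e e' : H e n.+1 = H e' n.+1 -> e = e'.
Proof.
move=> /(C_group_inj (tt_C_group hG) (@tt_index_sub _ _) (@tt_index_sub _ _)) eI.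
have : tt_index n e n.+1 n <-> tt_index n e' n.+1 n by rewrite eI.
rewrite /tt_index /tt_absent /=; case: e e' {eI} => -[] //; lia.
Qed.

Lemma tt_sub_indep e e' r : r <> n.+1 -> H e r = H e' r.
Proof.
move=> /eqP qn; apply: gen_by_ext => // i.
by rewrite /tt_index /tt_absent (negbTE qn).
Qed.

(** Cosets of different subgroups being different, sharing a facet forces the
    types to agree; the other faces belong to chambers of both types. *)
Lemma S_phi_eq (c d : Cham) r : r <= n.+2 ->
  phi c r = phi d r <->
  (r = n.+1 -> c.2 = d.2) /\ H c.2 r (sval c.1 * (sval d.1)^-1)%g.
Proof.
move=> rn; rewrite coset_phi_eq //; split=> -[h1 h2]; split=> //.
  by move=> er; apply: tt_sub_type; rewrite -er.
have [er|ne] := pselect (r = n.+1); first by rewrite h1.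
exact: tt_sub_indep.
Qed.

Lemma tt_comm i j : i.+2 <= j -> j < n.+1 -> (j = n -> i.+3 <= n) ->
  commute (G i) (G j).
Proof.
move=> ij jn h; rewrite /G /tt_gens.
have -> : (i == n) = false by lia.
case: (j =P n) => e; first by apply: (tt_comm_ab hG); lia.
by apply: (tt_comm_aa hG); lia.
Qed.

(** The reason for exchange: the subgroup at position [r] is the product of two
    commuting subgroups, generated by the nodes of the diagram before and after
    the removed one; the first fixes the faces of rank above that of [r] in the
    base flag, the second those below. *)
Lemma S_exchange : exchange n.+2 phi.
Proof.
split.
- move=> c d; apply/S_phi_eq => //; split=> //; rewrite tt_sub_all; last by left.
  apply: (subgroupM (gen_by_subgroup _ _)); first exact: (svalP c.1).
  by apply: (subgroupV (gen_by_subgroup _ _)); apply: (svalP d.1).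
- move=> c d; apply/S_phi_eq => //; split; first by lia.
  rewrite tt_sub_all; last by right.
  apply: (subgroupM (gen_by_subgroup _ _)); first exact: (svalP c.1).
  by apply: (subgroupV (gen_by_subgroup _ _)); apply: (svalP d.1).
move=> c d r rn /(S_phi_eq _ _ rn)[h1 h2].
(* The generators before and after the removed node.  From position [n] on no
   node comes after the removed ones, and all the others count as before. *)
pose lo := [set i | tt_index n c.2 r i /\ i.+1 < maxn r ((r >= n) * n.+2)].
pose hi := [set i | tt_index n c.2 r i /\ i.+1 >= maxn r ((r >= n) * n.+2)].
have lohi i j : lo i -> hi j -> commute (G i) (G j).
  move=> [[i1 i2] i3] [[j1 j2] j3]; apply: tt_comm => //.
    by move: i2 j2; rewrite /tt_absent; lia.
  by move: i2 j2; rewrite /tt_absent; lia.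
have [u [v [hu hv e]]] : exists u v, [/\ gen_by G lo u, gen_by G hi v &
    (sval c.1 * (sval d.1)^-1 = u * v)%g].
  apply: (gen_by_commuteU lohi); apply: gen_by_sub h2 => i hi'.
  by case: (leqP (maxn r ((r >= n) * n.+2)) i.+1) => ?; [right|left].
have lo_s s : r < s -> s <= n.+2 -> gen_by G lo `<=` H d.2 s.
  move=> rs sn; apply: gen_by_sub => i [[i1 i2] i3]; split=> //.
  by move: h1 i2 i3; rewrite /tt_absent; case: (c.2); case: (d.2); lia.
have hi_s e' s : s < r -> gen_by G hi `<=` H e' s.
  move=> rs; apply: gen_by_sub => i [[i1 i2] i3]; split=> //.
  by move: i2 i3; rewrite /tt_absent; case: (e'); case: (c.2); lia.
have Gs : is_subgroup (tt_group n a b) by apply: gen_by_subgroup.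
have Gu : tt_group n a b u by apply: gen_by_sub hu => i [[]].
have Gz := subgroupM Gs Gu (svalP d.1).
exists (exist _ _ Gz, if r == n.+2 then c.2 else d.2).
have uV : ((u * sval d.1) * (sval d.1)^-1 = u)%g by rewrite mulgK.
have comm := gen_by_commute lohi hu hv.
have vV : ((u * sval d.1) * (sval c.1)^-1 = v^-1)%g.
  apply: invg_inj; rewrite invgK invgF invgM mulgA e comm mulgK //.
split=> s.
  move=> sr; have sn := leq_trans sr rn; apply/S_phi_eq => //=; split.
    move=> es; case: (r =P n.+2) => // ?; rewrite h1 //; lia.
  rewrite vV; apply: (subgroupV (gen_by_subgroup _ _)).
  have [es|{}sr] : s = r \/ s < r by lia.
    rewrite es; apply: gen_by_sub hv => i [i1 _].
    by case: (r =P n.+2) => // ?; move: h1 i1;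
      rewrite /tt_index /tt_absent /=; case: (c.2); case: (d.2); lia.
  exact: hi_s hv.
move=> rs sn; apply/S_phi_eq => //=; split.
  by move=> es; case: (r =P n.+2) => // ?; lia.
rewrite uV; have [es|{}rs] : r = s \/ r < s by lia.
  apply: gen_by_sub hu => i [i1 _]; rewrite -es.
  by case: (r =P n.+2) => // ?; move: h1 i1;
      rewrite /tt_index /tt_absent /=; case: (c.2); case: (d.2); lia.
case: (r =P n.+2) => [?|_]; first by lia.
exact: lo_s hu.
Qed.

(** The intersection property turns common faces into a common set of
    generators. *)
Lemma S_agree (Q : set nat) (c d : Cham) :
  (forall s, s <= n.+2 -> Q s -> phi c s = phi d s) ->
  gen_by G [set i | i < n.+1 /\
    forall s, s < n.+3 -> Q s -> tt_index n c.2 s i]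
    (sval c.1 * (sval d.1)^-1)%g.
Proof.
move=> h; apply: (C_group_bigcap (tt_C_group hG)) => [s _ _||s sn Qs].
- exact: tt_index_sub.
- have sG : is_subgroup (tt_group n a b) by apply: gen_by_subgroup.
  exact: (subgroupM sG (svalP c.1) (subgroupV sG (svalP d.1))).
by have /S_phi_eq[] := h s sn Qs.
Qed.

Lemma S_phi_same_elt (c d : Cham) r : r <= n.+2 -> sval c.1 = sval d.1 ->
  phi c r = phi d r <-> (r = n.+1 -> c.2 = d.2).
Proof.
move=> rn e; rewrite S_phi_eq // e mulgV; split=> [[]//|h]; split=> //.
exact: gen_by1.
Qed.

Lemma flip_adjacent (c d : Cham) : sval c.1 = sval d.1 -> d.2 = ~~ c.2 ->
  adjacent_at n.+2 phi n.+1 c d.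
Proof.
move=> e1 e2 s sn; rewrite S_phi_same_elt // e2.
by split=> [h /h|ne /ne //]; case: (c.2).
Qed.

(** The position of the only face that a generator moves in a base flag whose
    facet it fixes. *)
Definition moved_position (i : nat) : nat := if i < n.-1 then i.+1 else n.

Lemma gen_adjacent i (c d : Cham) : i < n.+1 -> ~~ tt_absent n c.2 n.+1 i ->
  sval d.1 = (G i * sval c.1)%g -> d.2 = c.2 ->
  adjacent_at n.+2 phi (moved_position i) c d.
Proof.
move=> ilt abs e1 e2 s sn; rewrite S_phi_eq // e1 e2 invgM mulgA mulgV mul1g.
have sH : is_subgroup (H c.2 s) by apply: gen_by_subgroup.
have -> : (G i)^-1%g = G i by apply: involutionV; apply: (tt_involution hG).
split=> [[_ /(C_group_gen (tt_C_group hG) ilt (@tt_index_sub _ _))[_]]|sm].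
  by move: abs; rewrite /moved_position /tt_absent; case: (c.2); case: ifP; lia.
split=> //; apply: gen_by_gen; split=> //; move: abs sm.
by rewrite /moved_position /tt_absent; case: (c.2); case: ifP; lia.
Qed.

Lemma translate_chamber (c : Cham) i : i < n.+1 ->
  exists d : Cham, sval d.1 = (G i * sval c.1)%g /\ d.2 = c.2.
Proof.
move=> ilt; have sG : is_subgroup (tt_group n a b) by apply: gen_by_subgroup.
have Gi : tt_group n a b (G i) by apply: gen_by_gen.
by exists (exist _ _ (subgroupM sG Gi (svalP c.1)), c.2).
Qed.

Lemma S_adj_ex (c : Cham) r : 0 < r < n.+2 ->
  exists d, adjacent_at n.+2 phi r c d.
Proof.
move=> rn; have [er|ne] := pselect (r = n.+1).
  by exists (c.1, ~~ c.2); rewrite er; apply: flip_adjacent.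
pose i := if r == n then (if c.2 then n.-1 else n) else r.-1.
have ilt : i < n.+1 by rewrite /i; case: (c.2); case: ifP; lia.
have [d [d1 d2]] := translate_chamber c ilt; exists d.
have -> : r = moved_position i.
  rewrite /moved_position /i; case: (c.2); case: (r =P n) => ?; case: ifP; lia.
apply: gen_adjacent => //; rewrite /tt_absent /i.
by case: (c.2); case: (r =P n) => ?; lia.
Qed.

Lemma S_adj_uniq (c d d' : Cham) r : 0 < r < n.+2 ->
  adjacent_at n.+2 phi r c d -> adjacent_at n.+2 phi r c d' ->
  phi d r = phi d' r.
Proof.
move=> rn; have rn' : r <= n.+2 by lia.
have agr x : adjacent_at n.+2 phi r c x -> gen_by G [set i | i < n.+1 /\
    forall s, s < n.+3 -> s <> r -> tt_index n c.2 s i]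
    (sval c.1 * (sval x.1)^-1)%g.
  by move=> adj; apply: (@S_agree (fun s => s <> r)) => s sn sr; apply/adj.
move=> a1 a2.
have [er|ne] := pselect (r = n.+1).
  have same x : adjacent_at n.+2 phi r c x ->
      sval c.1 = sval x.1 /\ x.2 = ~~ c.2.
    move=> adj; have e : sval c.1 = sval x.1.
      apply: divg1_eq; have : gen_by G set0 (sval c.1 * (sval x.1)^-1)%g.
        apply: gen_by_sub (agr x adj) => i [ilt h].
        have := h (moved_position i); rewrite /tt_index /tt_absent /=.
        by rewrite /moved_position; case: (c.2); case: ifP; lia.
      by rewrite gen_by_set0.
    split=> //; case: (eqVneq x.2 c.2) => [e2|]; last by case: (x.2) (c.2) => -[].
    by case: (proj1 (adj r rn')) => //; apply/S_phi_same_elt.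
  have [e1 t1] := same _ a1; have [e2 t2] := same _ a2.
  by apply/S_phi_same_elt => //; rewrite -?e1 -?e2 ?t1 ?t2.
pose i := if r == n then (if c.2 then n.-1 else n) else r.-1.
have ilt : i < n.+1 by rewrite /i; case: (c.2); case: ifP; lia.
have elt x : adjacent_at n.+2 phi r c x -> (sval c.1 * (sval x.1)^-1 = G i)%g.
  move=> adj; have : gen_by G [set i] (sval c.1 * (sval x.1)^-1)%g.
    apply: gen_by_sub (agr x adj) => j [jlt h] /=.
    have h1 := h (moved_position j); have h2 := h n.+1; move: h1 h2.
    rewrite /i /moved_position /tt_index /tt_absent /=.
    by case: (c.2); case: ifP; case: ifP; lia.
  move/(gen_by1_involution (tt_involution hG ilt)) => -[/divg1_eq e|//].
  by case: (proj1 (adj r rn')) => //; apply/S_phi_same_elt.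
apply/S_phi_same_elt => //; apply: invg_inj; apply: (mulgI (sval c.1)).
by rewrite !elt.
Qed.

Lemma chamber_path_gen i k' j (c d : Cham) : j < n.+1 ->
  (forall s, s < n.+3 -> s <= i \/ k' <= s -> tt_index n c.2 s j) ->
  sval d.1 = (G j * sval c.1)%g -> d.2 = c.2 ->
  chamber_path n.+2 phi i k' c d.
Proof.
move=> jlt h e1 e2.
have step (x y : Cham) : x.2 = c.2 \/ i < n.+1 < k' ->
    ~~ tt_absent n x.2 n.+1 j -> sval y.1 = (G j * sval x.1)%g -> y.2 = x.2 ->
    chamber_path n.+2 phi i k' x y.
  move=> hx abs e1' e2'; apply: rt_step; exists (moved_position j); split; last first.
    exact: gen_adjacent.
  have := h (moved_position j); rewrite /tt_index /tt_absent /=.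
  by rewrite /moved_position; case: (c.2); case: ifP; lia.
case: (boolP (tt_absent n c.2 n.+1 j)) => abs; last by apply: step => //; left.
(* This generator does not fix the facet: do the step in the facet of the other
   type through the same ridge. *)
have ik : i < n.+1 < k'.
  by have := h n.+1; rewrite /tt_index /= abs; lia.
apply: (@rt_trans _ _ _ (c.1, ~~ c.2)).
  by apply: rt_step; exists n.+1; split=> //; apply: flip_adjacent.
apply: (@rt_trans _ _ _ (d.1, ~~ c.2)).
  apply: step => //; first by right.
  by move: abs; rewrite /tt_absent /=; case: (c.2) => /=; lia.
apply: rt_step; exists n.+1; split=> //; apply: flip_adjacent => //=.
by rewrite negbK.
Qed.

Lemma chamber_eq (c d : Cham) : sval c.1 = sval d.1 -> c.2 = d.2 -> c = d.
Proof.
by case: c d => [[x p] t] [[y q] t'] /= e ->; rewrite (eq_exist p q e).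
Qed.

Lemma S_conn (c d : Cham) i k' : i <= k' -> k' <= n.+2 ->
  agree_off n.+2 phi i k' c d -> chamber_path n.+2 phi i k' c d.
Proof.
move=> ik kn agr.
have hgen := S_agree agr; set I := [set j | _] in hgen.
have [e he ec] : exists2 e : Cham, sval e.1 = sval d.1 & e.2 = c.2.
  by exists (d.1, c.2).
apply: (@rt_trans _ _ _ e); last first.
  have [et|et] := eqVneq e.2 d.2.
    by rewrite (chamber_eq he et); apply: rt_refl.
  apply: rt_step; exists n.+1; split; last first.
    by apply: flip_adjacent => //; case: (e.2) (d.2) et => -[].
  apply/andP; split; rewrite ltnNge; apply/negP => hle.
    have := agr n.+1 (leqnSn _) (or_introl hle).
    by move/S_phi_eq => [] // /(_ erefl) ed; rewrite ec ed eqxx in et.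
  have := agr n.+1 (leqnSn _) (or_intror hle).
  by move/S_phi_eq => [] // /(_ erefl) ed; rewrite ec ed eqxx in et.
pose S := [set x | tt_group n a b x /\ forall c' d' : Cham,
  c'.2 = c.2 -> d'.2 = c.2 -> sval d'.1 = (x * sval c'.1)%g ->
  chamber_path n.+2 phi i k' c' d' /\ chamber_path n.+2 phi i k' d' c'].
have sG : is_subgroup (tt_group n a b) by apply: gen_by_subgroup.
have sS : is_subgroup S.
  apply: is_subgroupP => [|x y [Gx hx] [Gy hy]|x [Gx hx]].
  - split=> [|c' d' tc td]; first exact: (subgroup1 sG).
    rewrite mul1g => e'.
    have -> : c' = d' by apply: chamber_eq; rewrite ?e' ?tc ?td.
    by split; apply: rt_refl.
  - split=> [|c' d' tc td e']; first exact: (subgroupM sG Gx Gy).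
    pose m : Cham := (exist _ _ (subgroupM sG Gy (svalP c'.1)), c.2).
    have [//|//||p1 p2] := hy c' m; first by [].
    have [//|//||q1 q2] := hx m d'; first by rewrite e' mulgA.
    by split; [apply: rt_trans p1 q1|apply: rt_trans q2 p2].
  - split=> [|c' d' tc td e']; first exact: (subgroupV sG Gx).
    by have [//|//||p1 p2] := hx d' c'; first by rewrite e' mulVKg.
have : S (sval c.1 * (sval d.1)^-1)%g^-1%g.
  apply: (subgroupV sS); move: hgen; apply: (gen_by_min sS) => j [jlt hj].
  split=> [|c' d' tc td e']; first exact: gen_by_gen.
  have inv := tt_involution hG jlt.
  split; apply: (@chamber_path_gen i k' j); rewrite ?tc ?td // e'.
  by rewrite involutionK.
by move=> [_ /(_ c e)] []; rewrite ?invgF ?mulgVK.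
Qed.

Theorem S_thin_connected : thin_connected n.+2 phi.
Proof. by split; [exact: S_adj_ex|exact: S_adj_uniq|exact: S_conn]. Qed.

Theorem S_polytope : is_polytope n.+1 (S_poset n a b).
Proof.
have G1 : tt_group n a b 1%g by apply: gen_by1.
apply: (chambers_polytope (exist _ _ G1, true) S_chambering S_exchange).
exact: S_thin_connected.
Qed.

End TailTriangle.

(** * Symmetry, facets and stabilizers *)

Section Faces.
Variables (gT : groupType) (n : nat) (a : nat -> gT) (b : gT) (k : option nat).
Hypothesis hG : tail_triangle_C_group n a b k.
Let n_gt0 : 0 < n := tt_rank hG.
Let G := tt_gens n a b.
Let H e r := tt_sub n a b e r.
Let Cham := coset_chamber bool (tt_group n a b).
Let phi : Cham -> nat -> S_poset n a b := coset_phi (S_coset_system hG).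

Lemma tt_group_subgroup : is_subgroup (tt_group n a b).
Proof. exact: gen_by_subgroup. Qed.

Lemma tt_sub_group e r : H e r `<=` tt_group n a b.
Proof. by apply: gen_by_sub => i []. Qed.

Lemma S_botE (c : Cham) : S_bot n a b = phi c 0.
Proof.
have G1 : tt_group n a b 1%g by apply: gen_by1.
rewrite /phi (ex_bot (S_exchange hG) c (exist _ _ G1, true)).
apply: coset_face_inj; rewrite coset_phiE // /= rcoset1.
by congr pair; symmetry; apply: (tt_sub_all hG); left.
Qed.

Lemma S_topE (c : Cham) : S_top n a b = phi c n.+2.
Proof.
have G1 : tt_group n a b 1%g by apply: gen_by1.
rewrite /phi (ex_top (S_exchange hG) c (exist _ _ G1, true)).
apply: coset_face_inj; rewrite coset_phiE // /= rcoset1.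
congr pair; [lia|symmetry; apply: (tt_sub_all hG); by right].
Qed.

(** Translations act transitively on the chambers of a given type; the type is
    determined by the facet, and vertices lie in chambers of both types. *)
Theorem S_semiregular : is_semiregular n.+1 (S_poset n a b).
Proof.
have chP := S_chambering hG; have exP := S_exchange hG.
split=> [F0 F least0|F F'].
  have -> : (n.+1%:Z - 1 = n.+2%:Z - 1 - 1)%R by lia.
  move=> rF; have {}rF : rk F = (n.+1%:Z - 1)%R by rewrite rF; lia.
  have [_ [c eF]] := chamber_rank_ex chP rF.
  have e0 : F0 = phi c 0.
    have [_ _ anti] := chamber_order chP exP.
    by apply: anti; [apply: least0|apply: (chamber_bot_least chP exP)].
  rewrite eF e0; apply: (section_regular chP exP) => // x y _.
  move=> /(S_phi_eq hG _ _ (leqnSn _))[/(_ erefl) exy _].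
  have [f isof hf] := coset_translation (S_coset_system hG) x y.
  by exists f => // s sn; apply: hf; [lia|rewrite exy].
have e0 : ((1%:Z - 1)%R : int) = 0%R by [].
rewrite -e0 => /(chamber_rank_ex chP)[_ [c ->]] /(chamber_rank_ex chP)[_ [d ->]].
have [f isof hf] := coset_translation (S_coset_system hG) c d.
by exists f => //; apply: hf => //; apply: tt_sub_indep; lia.
Qed.

Lemma facet_type (F : S_poset n a b) :
  (facet_of_typeP F <-> exists2 c : Cham, F = phi c n.+1 & c.2 = true) /\
  (facet_of_typeQ F <-> exists2 c : Cham, F = phi c n.+1 & c.2 = false).
Proof.
have e1 : (n.+1%:Z - 1 = n%:Z)%R by lia.
split; split=> [[rF [x Gx eF]]|[c -> ec]].
- have [||c [-> _ ec]] := @coset_phi_surj _ _ _ _ _ _ (S_coset_system hG) F true x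
    n.+1 (leqnSn _) Gx; first by rewrite e1.
    by rewrite eF -(tt_sub_facetP hG).
  by exists c.
- split; first by rewrite /rk /= (minn_idPl (leqnSn _)).
  exists (sval c.1); first exact: (svalP c.1).
  by rewrite coset_phiE //= ec (tt_sub_facetP hG).
- have [||c [-> _ ec]] := @coset_phi_surj _ _ _ _ _ _ (S_coset_system hG) F false x
    n.+1 (leqnSn _) Gx; first by rewrite e1.
    by rewrite eF -(tt_sub_facetQ hG).
  by exists c.
- split; first by rewrite /rk /= (minn_idPl (leqnSn _)).
  exists (sval c.1); first exact: (svalP c.1).
  by rewrite coset_phiE //= ec (tt_sub_facetQ hG).
Qed.

Lemma facet_type_excl (F : S_poset n a b) :
  facet_of_typeP F -> facet_of_typeQ F -> False.
Proof.
move=> /(facet_type F).1[c -> ec] /(facet_type _).2[d e ed].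
by have [/(_ erefl)] := proj1 (S_phi_eq hG _ _ (leqnSn _)) e; rewrite ec ed.
Qed.

(** Intersecting the cosets below a facet with the facet turns them into cosets
    in the string group of the facet. *)
Lemma facet_iso (c : Cham) (g : nat -> gT) :
  (forall r, r <= n.+1 -> gen_by g (string_index n r) =
     gen_by G (tt_index n c.2 r `&` tt_index n c.2 n.+1)) ->
  isomorphic (section (phi c 0) (phi c n.+1)) (string_poset n g).
Proof.
move=> hg.
have facetE : gen_by g `I_n = H c.2 n.+1.
  have e := hg n.+1 (leqnn _); rewrite setIid in e.
  rewrite -[RHS]e; apply: gen_by_ext => // i; rewrite /string_index /=; lia.
have facet_sub x : gen_by g `I_n x -> H c.2 n.+1 x by rewrite facetE.
have sub x : gen_by g `I_n x -> tt_group n a b (x * sval c.1)%g.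
  rewrite facetE => hx; apply: (subgroupM tt_group_subgroup).
    exact: tt_sub_group hx.
  exact: (svalP c.1).
pose h (y : coset_chamber unit (gen_by g `I_n)) : Cham :=
  (exist _ _ (sub _ (svalP y.1)), c.2).
have sH := gen_by_subgroup.
have [|||||f [isof _]] := @chamber_map_iso _ _ n.+2 n.+1 _ _ phi
  (coset_phi (string_coset_system n g)) c 0 h (S_chambering hG) (S_exchange hG)
  (coset_chambering _) _; last exact: is_iso_isomorphic_sym isof.
- by [].
- by move=> y; apply: (ex_bot (S_exchange hG)).
- move=> y; apply/(S_phi_eq hG _ _ (leqnSn _)); split=> //=.
  by rewrite mulgK -/(H _ _) -facetE; apply: (svalP y.1).
- move=> x _ /(S_phi_eq hG _ _ (leqnSn _))[/(_ erefl) ex].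
  rewrite -/(H _ _) ex -facetE => hx.
  exists (exist _ _ hx, tt) => r _; congr (phi _ _).
  by apply: chamber_eq => //=; rewrite mulgVK.
move=> y z r rn; have rn2 : 0 + r <= n.+2 by lia.
rewrite (S_phi_eq hG _ _ rn2) coset_phi_eq //= invgM mulgA mulgK add0n.
have hw : gen_by g `I_n (sval y.1 * (sval z.1)^-1)%g.
  by apply: (sH _ _ _).2; [apply: (svalP y.1)|apply: (svalP z.1)].
have key : gen_by g (string_index n r) (sval y.1 * (sval z.1)^-1)%g <->
    H c.2 r (sval y.1 * (sval z.1)^-1)%g.
  rewrite hg //; split; first by apply: gen_by_sub => i [].
  move=> hr; apply: (C_group_setI (tt_C_group hG)) => //; try exact: tt_index_sub.
  exact: facet_sub hw.
by split=> [[_ /key]//|[_ /key]].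
Qed.

Lemma facetP_iso (c : Cham) : c.2 = true ->
  isomorphic (section (phi c 0) (phi c n.+1)) (string_poset n a).
Proof.
move=> ec; apply: facet_iso => r rn; rewrite ec; apply: gen_by_ext => i.
  by rewrite /string_index /tt_index /tt_absent /=; lia.
by move=> [ilt _]; rewrite /G /tt_gens; case: eqP => // ?; lia.
Qed.

Lemma facetQ_iso (c : Cham) : c.2 = false ->
  isomorphic (section (phi c 0) (phi c n.+1)) (string_poset n (tt_gensQ n a b)).
Proof.
move=> ec; apply: facet_iso => r rn; rewrite ec (tt_gensQ_gen hG); last by move=> i [].
congr gen_by; apply/seteqP; rewrite /string_index /tt_index /tt_absent.
split=> [_ [i [/= i1 i2] <-]|i /= [[i1 i2] [_ i3]]].
  by split=> /=; case: (i =P n.-1) => ?; lia.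
have [e|e] : i = n \/ i < n.-1 by lia.
  by exists n.-1; rewrite ?eqxx //=; lia.
by exists i => /=; [lia|case: eqP => // ?; lia].
Qed.

Theorem S_facets (F : S_poset n a b) : rk F = n%:Z%R ->
  [/\ facet_of_typeP F, ~ facet_of_typeQ F
    & isomorphic (section (S_bot n a b) F) (string_poset n a)] \/
  [/\ facet_of_typeQ F, ~ facet_of_typeP F
    & isomorphic (section (S_bot n a b) F) (string_poset n (tt_gensQ n a b))].
Proof.
have <- : (n.+1%:Z - 1 = n%:Z)%R by lia.
move=> /(chamber_rank_ex (S_chambering hG))[_ [c eF]].
case ec: c.2; [left|right].
  have tP : facet_of_typeP F by apply/(facet_type F).1; exists c.
  split=> // [tQ|]; first exact: facet_type_excl tP tQ.
  by rewrite (S_botE c) eF; apply: facetP_iso.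
have tQ : facet_of_typeQ F by apply/(facet_type F).2; exists c.
split=> // [tP|]; first exact: facet_type_excl tP tQ.
by rewrite (S_botE c) eF; apply: facetQ_iso.
Qed.

(** Every generator moves some face of the base flag of rank at most that of the
    ridge, so no generator is common to the stabilizers of these faces. *)
Theorem ridge_stabilizer (F : S_poset n a b) : rk F = (n%:Z - 1)%R ->
  facewise_stabilizer F = [set 1%g].
Proof.
have nn : n <= n.+2 by lia.
move=> /(chamber_rank_ex (S_chambering hG))[_ [c ->]].
apply/seteqP; split=> [x [Gx hx]|_ ->]; last first.
  by split=> [|K _]; [apply: gen_by1|rewrite rcoset1].
have Gd := subgroupM tt_group_subgroup (svalP c.1) Gx.
pose d : Cham := (exist _ _ Gd, c.2).
have : gen_by G set0 (sval d.1 * (sval c.1)^-1)%g.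
  have := @S_agree _ _ _ _ _ hG (fun s => s <= n) d c; move=> agr.
  apply: (gen_by_sub _ (agr _)) => [i [ilt hi]|s sn s_n].
    have := hi (moved_position n i); rewrite /moved_position /tt_index /tt_absent /=.
    by case: ifP; lia.
  apply: coset_face_inj; rewrite !coset_phiE //=; congr pair.
  rewrite -rcosetM; have := hx (phi c s) (chamber_le (S_chambering hG) c s_n nn).
  by rewrite coset_phiE.
rewrite gen_by_set0 /= => e; apply: (mulgI (sval c.1)).
by rewrite mulg1; apply: divg1_eq.
Qed.

End Faces.

(** * Vertex-figures *)

Section VertexFigure.
Variables (gT : groupType) (m : nat) (a : nat -> gT) (b : gT) (k : option nat).
Hypothesis hG : tail_triangle_C_group m.+1 a b k.
Hypothesis m_gt0 : 0 < m.
Let a0 := fun i => a i.+1.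
Let G := tt_gens m.+1 a b.

Lemma gen_by_shift (I : set nat) :
  gen_by (tt_gens m a0 b) I = gen_by G (succn @` I).
Proof. by apply: gen_by_reindex. Qed.

(** Subgroups generated by part of the shifted list are generated by part of the
    original list, from which the intersection property is inherited. *)
Theorem vertex_tail_triangle : tail_triangle_C_group m a0 b k.
Proof.
split=> //.
- by move=> i im; apply: (tt_involution hG (i := i.+1)).
- by move=> i j im jm ij; apply: (tt_comm_aa hG); lia.
- by move=> i im; apply: (tt_comm_ab hG); lia.
- exact: tt_period_ge2 hG.
- by have := tt_period hG; rewrite /a0 /= prednK.
split=> [i im|I J Im Jm]; first by apply: (tt_involution hG (i := i.+1)).
rewrite !gen_by_shift (tt_C_group hG).2.
- congr gen_by; apply/seteqP; split=> [_ [[i Ii <-] [j Jj [ej]]]|_ [i [Ii Ji] <-]].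
    by exists i => //; split=> //; rewrite -ej.
  by split; exists i.
- by move=> _ [i /Im /= im <-] /=; lia.
- by move=> _ [i /Jm /= im <-] /=; lia.
Qed.

Let hG0 := vertex_tail_triangle.
Let Cham := coset_chamber bool (tt_group m.+1 a b).
Let phi : Cham -> nat -> S_poset m.+1 a b := coset_phi (S_coset_system hG).

(** As for facets, cosets are intersected with the vertex; positions are shifted
    by one because the vertex becomes the least face. *)
Theorem vertex_figure_iso (v : S_poset m.+1 a b) : rk v = 0%R ->
  isomorphic (section v (S_top m.+1 a b)) (S_poset m a0 b).
Proof.
have e0 : ((1%:Z - 1)%R : int) = 0%R by [].
rewrite -e0 => /(chamber_rank_ex (S_chambering hG))[_ [c ->]].
rewrite (S_topE hG c) {v e0}.
have vertexE : tt_group m a0 b = gen_by G (tt_index m.+1 c.2 1).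
  rewrite /tt_group gen_by_shift; congr gen_by; apply/seteqP.
  rewrite /tt_index /tt_absent; split=> [_ [i /= im <-]|[|i] /= [i1 i2]] /=.
  - by case: (c.2); lia.
  - by move: i2; case: (c.2); lia.
  - by exists i => /=; lia.
have vertex_sub x : tt_group m a0 b x -> gen_by G (tt_index m.+1 c.2 1) x.
  by rewrite vertexE.
have sub x : tt_group m a0 b x -> tt_group m.+1 a b (x * sval c.1)%g.
  move=> /vertex_sub hx; apply: (subgroupM (tt_group_subgroup m.+1 a b)).
    exact: tt_sub_group hx.
  exact: (svalP c.1).
pose h (y : coset_chamber bool (tt_group m a0 b)) : Cham :=
  (exist _ _ (sub _ (svalP y.1)), y.2).
have sH := gen_by_subgroup.
have [|||||f [isof _]] := @chamber_map_iso _ _ m.+3 m.+2 _ _ phi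
  (coset_phi (S_coset_system hG0)) c 1 h (S_chambering hG) (S_exchange hG)
  (S_chambering hG0) _; last exact: is_iso_isomorphic_sym isof.
- by [].
- move=> y; apply/(S_phi_eq hG) => //=; split; first by lia.
  rewrite mulgK (@tt_sub_indep _ _ _ _ _ c.2); last by lia.
  by apply: vertex_sub; apply: (svalP y.1).
- by move=> y; apply: (ex_top (S_exchange hG)).
- move=> x /(S_phi_eq hG _ _ (ltn0Sn _))[_ hx] _.
  have {}hx : tt_group m a0 b (sval x.1 * (sval c.1)^-1)%g.
    by rewrite vertexE -/(tt_sub m.+1 a b c.2 1) (@tt_sub_indep _ _ _ _ _ x.2) //; lia.
  exists (exist _ _ hx, x.2) => r _; congr (phi _ _).
  by apply: chamber_eq => //=; rewrite mulgVK.
move=> y z r rn; have rn2 : 1 + r <= m.+3 by lia.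
rewrite (S_phi_eq hG _ _ rn2) (S_phi_eq hG0) //= invgM mulgA mulgK.
set w := (sval y.1 / sval z.1)%g.
have hw : tt_group m a0 b w.
  by apply: (sH _ _ _).2; [apply: (svalP y.1)|apply: (svalP z.1)].
have shiftE : tt_sub m a0 b y.2 r =
    gen_by G (tt_index m.+1 y.2 r.+1 `&` tt_index m.+1 c.2 1).
  rewrite /tt_sub gen_by_shift; congr gen_by; apply/seteqP.
  rewrite /tt_index /tt_absent; split=> [_ [i [/= i1 i2] <-]|[|i] /= [[i1 i2] [_ i3]]] /=.
  - by move: i2; case: (y.2); case: (c.2); lia.
  - by move: i3; case: (c.2); lia.
  - by exists i => //=; split; [lia|move: i2; case: (y.2); lia].
have key : tt_sub m a0 b y.2 r w <-> tt_sub m.+1 a b y.2 r.+1 w.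
  rewrite shiftE; split; first by apply: gen_by_sub => i [].
  move=> hr; apply: (C_group_setI (tt_C_group hG)) => //; try exact: tt_index_sub.
  exact: vertex_sub.
rewrite key add1n; split=> -[h1 h2]; split=> // e; apply: h1; lia.
Qed.

End VertexFigure.

(** * Alternating walks in dihedral groups *)

Section Walk.
Variables (gT : groupType) (al be : gT).
Hypotheses (inv_al : involution al) (inv_be : involution be).

Definition alt_gen (e : bool) : gT := if e then al else be.

(** Factors are added on the left, like the steps of a walk; [e] is the colour of
    the first step. *)
Fixpoint alt (e : bool) (d : nat) : gT :=
  if d is d'.+1 then (alt_gen (e (+) odd d') * alt e d')%g else 1%g.

Lemma alt_gen_involution e : involution (alt_gen e).
Proof. by case: e. Qed.

Lemma alt_rcons e d : alt e d.+1 = (alt (~~ e) d * alt_gen e)%g.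
Proof.
elim: d => [|d IH]; first by rewrite /= addbF mulg1 mul1g.
rewrite -[LHS]/(alt_gen (e (+) odd d.+1) * alt e d.+1)%g IH mulgA /=.
by rewrite addbN addNb.
Qed.

Lemma alt_odd_neq1 e t : alt e t.*2.+1 <> 1%g.
Proof.
elim: t e => [|t IH] e; first by rewrite /= mulg1; case: (alt_gen_involution (e (+) false)).
rewrite doubleS -[LHS]/(alt_gen (e (+) odd t.*2.+2) * alt e t.*2.+2)%g.
have -> : e (+) odd t.*2.+2 = e by rewrite /= odd_double addbF.
rewrite alt_rcons => h; apply: (IH (~~ e)).
have inv := alt_gen_involution e.
apply: (mulIg (alt_gen e)); apply: (mulgI (alt_gen e)).
by rewrite h mul1g; case: inv => _ <-; rewrite expg2.
Qed.

Lemma alt_even e t : alt e t.*2 = ((alt_gen (~~ e) * alt_gen e) ^+ t)%g.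
Proof.
elim: t => [|t IH]; first by [].
rewrite doubleS expgS -IH -[LHS]/(alt_gen (e (+) odd t.*2.+1) *
  (alt_gen (e (+) odd t.*2) * alt e t.*2))%g /= odd_double /= addbT addbF mulgA.
by [].
Qed.

Lemma alt_gen_swapX t : ((alt_gen false * alt_gen true) ^+ t =
  ((al * be) ^+ t)^-1)%g.
Proof.
have -> : (alt_gen false * alt_gen true = (al * be)^-1)%g.
  by rewrite invgM !involutionV.
exact: expVgn.
Qed.

(** An alternating product of odd length is conjugate to a generator, so only
    those of even length, the powers of the rotation, can be trivial. *)
Lemma alt_eq1 e d : alt e d = 1%g -> exists2 t, d = t.*2 & ((al * be) ^+ t = 1)%g.
Proof.
have [od|ev] := boolP (odd d).
  have -> : d = d./2.*2.+1 by rewrite -[LHS]odd_double_half od.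
  by move/alt_odd_neq1.
have -> : d = d./2.*2 by rewrite -[LHS]odd_double_half (negbTE ev).
rewrite alt_even => h; exists d./2 => //; case: e h => //=.
by rewrite alt_gen_swapX => h; apply: invg_inj; rewrite h invg1.
Qed.

Lemma alt_period t e : ((al * be) ^+ t = 1)%g -> alt e t.*2 = 1%g.
Proof.
by move=> h; rewrite alt_even; case: e; rewrite /= ?alt_gen_swapX h // invg1.
Qed.

Lemma alt_add e d d' : alt e (d + d') = (alt (e (+) odd d') d * alt e d')%g.
Proof.
elim: d => [|d IH]; first by rewrite mul1g.
by rewrite addSn /= IH mulgA oddD addbA addbAC.
Qed.

(** The elements of the dihedral group, listed in the order in which they are
    met by applying the two generators alternately; [p] tells which one comes
    next.  Field [walk_mem] says that nothing outside the dihedral group is met,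
    and [walk_onto] below that nothing is missed. *)
Record dihedral_walk (I : Type) (s : I -> I) (w : I -> gT) (p : I -> bool) :
    Prop := {
  walk_one : exists i, w i = 1%g;
  walk_step : forall i, w (s i) = (alt_gen (p i) * w i)%g;
  walk_color : forall i, p (s i) = ~~ p i;
  walk_prev : forall j, exists i, j = s i;
  walk_mem : forall K, is_subgroup K -> K al -> K be -> forall i, K (w i);
  walk_inj : injective w }.

Lemma alt_mem K : is_subgroup K -> K al -> K be -> forall e d, K (alt e d).
Proof.
move=> sK Ka Kb e; elim=> [|d IH]; first exact: (subgroup1 sK).
by apply: (subgroupM sK) => //=; case: (_ (+) _).
Qed.

Lemma walk_onto (I : Type) (s : I -> I) w p (g : nat -> gT) (J : set nat) :
  dihedral_walk s w p -> (forall j, J j -> g j = al \/ g j = be) ->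
  forall v, gen_by g J v -> exists i, w i = v.
Proof.
move=> dw hJ v hv.
pose S := [set x | (forall i, exists j, (x * w i)%g = w j) /\
  forall i, exists j, (x^-1 * w i)%g = w j].
have sS : is_subgroup S.
  apply: is_subgroupP => [|x y [x1 x2] [y1 y2]|x [x1 x2]].
  - by split=> i; exists i; rewrite ?invg1 mul1g.
  - split=> i.
      by have [j e] := y1 i; have [l e'] := x1 j; exists l; rewrite -mulgA e.
    by have [j e] := x2 i; have [l e'] := y2 j; exists l; rewrite invgM -mulgA e.
  - by split=> // i; rewrite invgK.
have gS e : S (alt_gen e).
  suff h i : exists j, (alt_gen e * w i)%g = w j.
    by split=> i //; rewrite involutionV //; apply: alt_gen_involution.
  have [<-|ne] := eqVneq (p i) e; first by exists (s i); rewrite (walk_step dw).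
  have [j ej] := walk_prev dw i; exists j.
  have pj : p j = e.
    by move: ne; rewrite ej (walk_color dw); case: (p j); case: e.
  by rewrite ej (walk_step dw) pj involutionK //; apply: alt_gen_involution.
have [i wi] := walk_one dw.
have [|h _] := gen_by_min sS _ hv.
  by move=> j /hJ[]->; [apply: (gS true)|apply: (gS false)].
by have [j] := h i; rewrite wi mulg1 => ->; exists j.
Qed.

Lemma walk_iter (I : Type) (s : I -> I) (w : I -> gT) (p : I -> bool) :
  (forall i, w (s i) = (alt_gen (p i) * w i)%g) ->
  (forall i, p (s i) = ~~ p i) ->
  forall d i, w (iter d s i) = (alt (p i) d * w i)%g.
Proof.
move=> ws ps d i; have pd j : p (iter j s i) = p i (+) odd j.
  by elim: j => [|j IH]; rewrite /= ?addbF // ps IH addbN.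
by elim: d => [|d IH]; [rewrite mul1g|rewrite iterS ws IH pd mulgA].
Qed.

Lemma finite_walk m : 1 < m -> has_period (al * be)%g (Some m) ->
  exists (w : 'I_m.*2 -> gT) (p : 'I_m.*2 -> bool), dihedral_walk (@ordS m.*2) w p /\
    forall e, ([set i | p i = e] #= `I_m)%card.
Proof.
move=> m1 [_ xm xj].
pose w (i : 'I_m.*2) := alt true i; pose p (i : 'I_m.*2) := ~~ odd i.
have i0 : 0 < m.*2 by lia.
have ws i : w (ordS i) = (alt_gen (p i) * w i)%g.
  rewrite /w /=; have [lt|] := ltnP i.+1 m.*2; first by rewrite modn_small.
  move=> le; have e : i.+1 = m.*2 by have := ltn_ord i; lia.
  rewrite e modnn; transitivity (alt true i.+1); last by [].
  by rewrite e alt_period.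
(* Equal elements at distance [d] give a trivial alternating product of [d]
   factors, hence a trivial power of the rotation. *)
have inj (i j : 'I_m.*2) : i <= j -> w i = w j -> i = j.
  move=> ij; rewrite /w -(subnK ij) alt_add => e.
  have /alt_eq1[t et ht] : alt (true (+) odd i) (j - i) = 1%g.
    by apply: (mulIg (alt true i)); rewrite -e mul1g.
  apply: val_inj => /=; have jm := ltn_ord j.
  have [t0|t0] := posnP t; first by lia.
  by case: (xj t) => //; lia.
exists w, p; split; [split=> //|].
- by exists (Ordinal i0).
- by move=> i; rewrite /p /= odd_mod ?odd_double.
- by move=> j; exists (ord_pred j); rewrite ord_predK.
- by move=> K sK Ka Kb i; apply: alt_mem.
- move=> i j e; have [ij|/ltnW ji] := leqP i j; first exact: inj.
  by symmetry; apply: inj.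
move=> e; pose f (j : nat) : 'I_m.*2 := insubd (Ordinal i0) (j.*2 + ~~ e).
have fE j : j < m -> val (f j) = j.*2 + ~~ e.
  by move=> jm; rewrite val_insubd ifT //; case: (e); lia.
have -> : [set i | p i = e] = f @` `I_m.
  apply/seteqP; split=> [i /= pi|_ [j /= jm <-]] /=; last first.
    by rewrite /p fE // oddD odd_double; case: (e).
  exists i./2 => /=; first by have := ltn_ord i; lia.
  apply: val_inj; rewrite fE; last by have := ltn_ord i; lia.
  by rewrite -pi /p negbK /= addnC odd_double_half.
apply: inj_card_eq => i j; rewrite !inE /= => im jm /(congr1 val).
by rewrite !fE //; lia.
Qed.

Lemma infinite_walk : has_period (al * be)%g None ->
  exists (w : int -> gT) (p : int -> bool),
    dihedral_walk (fun i : int => (i + 1)%R) w p /\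
    forall e, ([set i | p i = e] #= [set: nat])%card.
Proof.
move=> xj.
(* Walking backwards from the identity exchanges the two generators. *)
pose w (i : int) := match i with Posz j => alt true j | Negz j => alt false j.+1 end.
pose p (i : int) := match i with Posz j => ~~ odd j | Negz j => odd j end.
have sN j : (Negz j.+1 + 1)%R = Negz j by lia.
have sP j : (Posz j + 1)%R = Posz j.+1 by lia.
have s0 : (Negz 0 + 1)%R = Posz 0 by lia.
have ws i : w (i + 1)%R = (alt_gen (p i) * w i)%g.
  case: i => [j|[|j]]; rewrite ?sN ?sP ?s0 //=.
    by rewrite mulg1 -expg2; case: inv_be => _ ->.
  by rewrite involutionK //; apply: alt_gen_involution.
have ps i : p (i + 1)%R = ~~ p i.
  by case: i => [j|[|j]]; rewrite ?sN ?sP ?s0 //= negbK.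
have inj (i j : int) : (i <= j)%R -> w i = w j -> i = j.
  move=> ij; have [d ->] : exists d : nat, j = (i + d%:Z)%R.
    by exists (absz (j - i)%R); lia.
  have <- : iter d (fun i : int => (i + 1)%R) i = (i + d%:Z)%R.
    by elim: d => [|d IH] /=; [lia|rewrite IH; lia].
  rewrite (walk_iter ws ps) => e.
  have /alt_eq1[t et ht] : alt (p i) d = 1%g.
    by apply: (mulIg (w i)); rewrite -e mul1g.
  have [t0|t0] := posnP t; first by rewrite et t0.
  by case: (xj t t0).
exists w, p; split; [split=> //|].
- by exists (Posz 0).
- by move=> j; exists (j - 1)%R; lia.
- by move=> K sK Ka Kb [j|j]; apply: alt_mem.
- move=> i j e; have [ij|ji] : (i <= j)%R \/ (j <= i)%R by lia.
    exact: inj.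
  by symmetry; apply: inj.
move=> e; apply: eq_card_nat => //; apply/infiniteP.
pose f (j : nat) := Posz (j.*2 + ~~ e).
have fi : f @` [set: nat] `<=` [set i | p i = e].
  by move=> _ [j _ <-] /=; rewrite oddD odd_double; case: (e).
have finj : {in [set: nat] &, injective f} by move=> i j _ _ []; lia.
have := inj_card_eq finj; rewrite card_eq_le => /andP[_ h].
exact: card_le_trans h (subset_card_le fi).
Qed.

Lemma walk_ex (k : option nat) : (if k is Some m then 1 < m else true) ->
  has_period (al * be)%g k ->
  exists (w : polygon_index (omap double k) -> gT) p,
    dihedral_walk (@polygon_succ (omap double k)) w p /\
    forall e, has_card [set i | p i = e] k.
Proof.
case: k => [m|] k2 hk; first exact: finite_walk.
exact: infinite_walk.
Qed.

End Walk.

(** * Polygons and sections of rank two *)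

(** The chamber [(i, d)] consists of the edge [i] and one of its two ends. *)
Definition polygon_phi (I : Type) (s : I -> I) (c : I * bool) (r : nat) :
    polygon_face I :=
  match r with
  | 0 => PBot
  | 1 => PVertex (if c.2 then c.1 else s c.1)
  | 2 => PEdge c.1
  | _ => PTop
  end.

Lemma polygon_chambering (I : Type) (s : I -> I) (i0 : I) :
  chambering 3 (polygon_phi s :
    _ -> _ -> @Ranked (polygon_face I) (polygon_le s) (@polygon_rk I)).
Proof.
split=> [c [|[|[|[|r]]]] //|F|F F'].
  case: F => [|i|i|].
  - by exists (i0, true), 0.
  - by exists (i, true), 1.
  - by exists (i, true), 2.
  - by exists (i0, true), 3.
split=> [|[[i d] [r [s' [rs s3 -> ->]]]]]; last first.
  case: r s' rs s3 => [|[|[|[|r]]]] [|[|[|[|s']]]] //= _ _.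
  by case: d; [left|right].
case: F F' => [|i|i|] [|j|j|] //= h.
- by exists (i0, true), 0, 0.
- by exists (j, true), 0, 1.
- by exists (j, true), 0, 2.
- by exists (i0, true), 0, 3.
- by exists (i, true), 1, 1; rewrite -h.
- by case: h => ->; [exists (j, true), 1, 2|exists (j, false), 1, 2].
- by exists (i, true), 1, 3.
- by exists (i, true), 2, 2; rewrite -h.
- by exists (i, true), 2, 3.
- by exists (i0, true), 3, 3.
Qed.

Section RankTwo.
Variables (gT : groupType) (n : nat) (a : nat -> gT) (b : gT) (k : option nat).
Hypothesis hG : tail_triangle_C_group n a b k.
Let n_gt0 : 0 < n := tt_rank hG.
Let G := tt_gens n a b.
Let H e r := tt_sub n a b e r.
Let Cham := coset_chamber bool (tt_group n a b).
Let phi : Cham -> nat -> S_poset n a b := coset_phi (S_coset_system hG).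
Let I := polygon_index (omap double k).
Let s : I -> I := @polygon_succ (omap double k).

(** The facets around a face of co-rank 2, together with the ridges between
    them, are met by walking in the dihedral group generated by the two ends of
    the triangle; the subgroup of the face is the product of this dihedral group
    and a group that fixes all these facets and ridges. *)
Lemma corank2_iso (c : Cham) :
  exists f : polygon (omap double k) -> section (phi c n.-1) (phi c (n.-1 + 3)),
  exists p : I -> bool,
  [/\ is_iso f, forall i, p (s i) = ~~ p i,
      forall i, exists2 d : Cham, sval (f (PEdge i)) = phi d n.+1 & d.2 = p i,
      forall F, rk (sval (f F)) = (rk F + n%:Z - 1)%R
    & forall e, has_card [set i | p i = e] k].
Proof.
have inv_al : involution (G n.-1) by apply: (tt_involution hG); lia.
have inv_be : involution (G n) by apply: (tt_involution hG); lia.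
have alE : G n.-1 = a n.-1 by rewrite /G /tt_gens; case: eqP => // ?; lia.
have beE : G n = b by rewrite /G /tt_gens eqxx.
have [w [p [dw hp]]] : exists (w : I -> gT) p,
    dihedral_walk (G n.-1) (G n) s w p /\ forall e, has_card [set i | p i = e] k.
  apply: walk_ex => //; first exact: tt_period_ge2 hG.
  by rewrite alE beE; apply: tt_period hG.
pose D := [set i | i = n.-1 \/ i = n].
have wD i : gen_by G D (w i).
  apply: (walk_mem dw); first exact: gen_by_subgroup.
    by apply: gen_by_gen; left.
  by apply: gen_by_gen; right.
have D_I : D `<=` `I_n.+1 by move=> i [] -> /=; lia.
have wG i : tt_group n a b (w i * sval c.1)%g.
  apply: (subgroupM (tt_group_subgroup n a b)); last exact: (svalP c.1).
  exact: gen_by_sub (wD i).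
pose tip (y : I * bool) := if y.2 then y.1 else s y.1.
pose h (y : I * bool) : Cham := (exist _ _ (wG (tip y)), p y.1).
have hdiv y z : (sval (h y).1 * (sval (h z).1)^-1 = w (tip y) * (w (tip z))^-1)%g.
  by rewrite /= invgM mulgA mulgK.
have wdiv i j : gen_by G D (w i * (w j)^-1)%g.
  by apply: (gen_by_subgroup _ _).2; apply: wD.
have sH e r : is_subgroup (H e r) by apply: gen_by_subgroup.
have n1 : n.-1 <= n.+2 by lia.
have nn : n <= n.+2 by lia.
have n3 : n.-1 + 3 = n.+2 by lia.
have n12 : n.-1 + 1 = n by lia.
have n22 : n.-1 + 2 = n.+1 by lia.
(* Inside the dihedral group, the base facet of type [e] is fixed by the two
   powers of one generator only, and the base ridge by nothing but 1. *)
have alt_facet e : H e n.+1 (alt_gen (G n.-1) (G n) e).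
  by case: e; apply: gen_by_gen; rewrite /tt_index /tt_absent /=; lia.
have facet_D e x : H e n.+1 x -> gen_by G D x ->
    x = 1%g \/ x = alt_gen (G n.-1) (G n) e.
  move=> hx hD; have inv := alt_gen_involution inv_al inv_be e.
  pose l := if e then n.-1 else n.
  have gl : alt_gen (G n.-1) (G n) e = G l by rewrite /l; case: (e).
  rewrite gl in inv *; apply: gen_by1_involution => //.
  have := C_group_setI (tt_C_group hG) (@tt_index_sub n e n.+1) D_I hx hD.
  apply: gen_by_sub => i [[_ i2] [] ei] /=; move: i2; rewrite ei /tt_absent /l;
    by case: (e); lia.
have ridge_D e x : H e n x -> gen_by G D x -> x = 1%g.
  move=> hx hD; have : gen_by G set0 x; last by rewrite gen_by_set0.
  have := C_group_setI (tt_C_group hG) (@tt_index_sub n e n) D_I hx hD.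
  by apply: gen_by_sub => i [[_ i2] [] ei] /=; move: i2; rewrite ei /tt_absent;
    case: (e); lia.
have tip_facet i d : H (p i) n.+1 (w (tip (i, d)) * (w i)^-1)%g.
  case: d; rewrite /tip /=; first by rewrite mulgV; apply: subgroup1.
  by rewrite (walk_step dw) mulgK.
have [i0 _] := walk_one dw.
have h0 y : phi (h y) n.-1 = phi c n.-1.
  apply/(S_phi_eq hG _ _ n1); split; first by lia.
  rewrite /= mulgK; apply: gen_by_sub (wD _) => i [] ->;
    by rewrite /tt_index /tt_absent /=; case: (p _); lia.
have h3 y : phi (h y) (n.-1 + 3) = phi c (n.-1 + 3).
  by rewrite n3; apply: (ex_top (S_exchange hG)).
have n3' : n.-1 + 3 <= n.+2 by rewrite n3.
have [|y z r|f [isof fE]] := @chamber_map_iso _ (polygon (omap double k))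
  n.+2 3 _ _ phi (polygon_phi s) c n.-1 h
  (S_chambering hG) (S_exchange hG) (polygon_chambering s i0) n3' h0 h3.
- move=> x /(S_phi_eq hG _ _ n1)[_ hx] _.
  pose lo := [set i | i.+2 < n].
  have [u [v [hu hv e]]] : exists u v, [/\ gen_by G lo u, gen_by G D v &
      (sval x.1 * (sval c.1)^-1 = u * v)%g].
    apply: gen_by_commuteU.
      by move=> i j; rewrite /lo => /= il [] ->; apply: (tt_comm hG); lia.
    apply: gen_by_sub hx => i [i1 i2] /=.
    have [il|il] : i.+2 < n \/ n.-1 <= i; last by right; rewrite /D /=; lia.
      by move: i2; rewrite /tt_absent; lia.
    by left.
  have [j wj] : exists j, w j = v.
    by apply: (walk_onto inv_al inv_be dw _ hv) => i [] ->; [left|right].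
  have [y ty py] : exists2 y, tip y = j & p y.1 = x.2.
    have [pj|pj] := eqVneq (p j) x.2; first by exists (j, true).
    have [i ei] := walk_prev dw j; exists (i, false) => //=.
    by move: pj; rewrite ei (walk_color dw); case: (p i); case: (x.2).
  exists y => r r3; have [->|r0] := posnP r.
    rewrite addn0 h0; apply/(S_phi_eq hG _ _ n1); split=> //; lia.
  apply/(S_phi_eq hG); first by lia.
  split; first by rewrite /= py.
  have -> : (sval x.1 * (sval (h y).1)^-1 = u)%g.
    by rewrite /= ty wj invgM mulgA e mulgK.
  apply: gen_by_sub hu => i; rewrite /lo => /= il; split; first by lia.
  by rewrite /tt_absent; case: (x.2); lia.
- case: r => [|[|[|[|r]]]] // _.
  + by rewrite addn0 !h0.
  + rewrite n12 (S_phi_eq hG _ _ nn) hdiv /=; split=> [[_ hx]|[e]].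
      congr PVertex; apply: (walk_inj dw); apply: divg1_eq.
      exact: ridge_D hx (wdiv _ _).
    rewrite /tip e mulgV; split; [by lia|exact: subgroup1].
  + rewrite n22 (S_phi_eq hG _ _ (leqnSn _)) hdiv /=.
    case: y z => [i d] [j d'] /=; split=> [[/(_ erefl) pij hx]|[<-]]; last first.
      split=> //; have := subgroupM (sH _ _) (tip_facet i d)
        (subgroupV (sH _ _) (tip_facet i d')).
      by rewrite invgF mulgA mulgVK.
    congr PEdge.
    have : H (p i) n.+1 (w i * (w j)^-1)%g.
      have hj := tip_facet j d'; rewrite -pij in hj.
      have := subgroupM (sH _ _) (subgroupM (sH _ _)
        (subgroupV (sH _ _) (tip_facet i d)) hx) hj.
      by rewrite invgF !mulgA !mulgVK.
    move/facet_D => /(_ (wdiv _ _))[/divg1_eq /(walk_inj dw) //|e].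
    have ei : i = s j.
      apply: (walk_inj dw); rewrite (walk_step dw) -pij -e.
      by rewrite mulgVK.
    by move: (walk_color dw j); rewrite -ei pij; case: (p j).
  + by rewrite !h3.
exists f, p; split=> // [i|i|F]; first exact: (walk_color dw).
  exists (h (i, true)) => //.
  by have := fE (i, true) 2 isT; rewrite n22.
have chQ := polygon_chambering s i0.
have [y [r [r3 eF]]] := ch_surj chQ F.
rewrite [in LHS]eF fE // (ch_rk (S_chambering hG)); last by lia.
by have := ch_rk chQ y r3; rewrite -eF => ->; lia.
Qed.

(** The facets of one type around a face of co-rank 2 are the images of the edges
    of one colour of the polygon, of which there are [k]. *)
Theorem corank2_faces (R : S_poset n a b) : rk R = (n%:Z - 2)%R ->
  [/\ has_card [set F | facet_of_typeP F /\ fle R F] k,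
      has_card [set F | facet_of_typeQ F /\ fle R F] k
    & exists2 f : polygon (omap double k) -> section R (S_top n a b),
        is_iso f
        & forall i : polygon_index (omap double k),
            let F := sval (f (PEdge i)) in
            let F' := sval (f (PEdge (polygon_succ i))) in
            (facet_of_typeP F /\ facet_of_typeQ F') \/
            (facet_of_typeQ F /\ facet_of_typeP F')].
Proof.
have <- : (n.-1%:Z - 1 = n%:Z - 2)%R by lia.
move=> /(chamber_rank_ex (S_chambering hG))[_ [c ->]].
have n3 : n.-1 + 3 = n.+2 by lia.
have -> : S_top n a b = phi c (n.-1 + 3) by rewrite n3; apply: S_topE.
rewrite -/phi.
have [f [p [isof ps pd pr pk]]] := corank2_iso c.
have tP i : p i = true -> facet_of_typeP (sval (f (PEdge i))).
  by move=> pi; apply/(facet_type hG _).1; have [d e ed] := pd i;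
    exists d; rewrite // ed.
have tQ i : p i = false -> facet_of_typeQ (sval (f (PEdge i))).
  by move=> pi; apply/(facet_type hG _).2; have [d e ed] := pd i;
    exists d; rewrite // ed.
have [[g fg gf] lf] := isof.
have fI i j : sval (f (PEdge i)) = sval (f (PEdge j)) -> i = j.
  by move=> e; have := congr1 g (section_inj e); rewrite !fg => -[].
have edge (F : S_poset n a b) : rk F = n%:Z%R -> fle (phi c n.-1) F ->
    exists i, F = sval (f (PEdge i)).
  move=> rF l; have lF : fle F (phi c (n.-1 + 3)).
    by rewrite n3; apply: (chamber_top_greatest (S_chambering hG) (S_exchange hG)).
  have [F' eF] : exists F', F = sval (f F').
    exists (g (exist (fun K => fle (phi c n.-1) K /\ fle K (phi c (n.-1 + 3))) F
      (conj l lF))).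
    by rewrite gf.
  have := pr F'; rewrite -eF rF; case: F' eF => [|i|i|] eF //=; try lia.
  by exists i.
have card_edges (T : S_poset n a b -> Prop) e :
    (forall i, p i = e -> T (sval (f (PEdge i)))) ->
    (forall i, T (sval (f (PEdge i))) -> p i = e) ->
    (forall F, T F -> rk F = n%:Z%R) ->
    has_card [set F | T F /\ fle (phi c n.-1) F] k.
  move=> h1 h2 h3.
  have -> : [set F | T F /\ fle (phi c n.-1) F] =
      (fun i => sval (f (PEdge i))) @` [set i | p i = e].
    apply/seteqP; split=> [F [tF l]|_ [i pi <-]].
      by have [i eF] := edge F (h3 F tF) l; exists i => //=; apply: h2; rewrite -eF.
    by split; [apply: h1|case: (svalP (f (PEdge i)))].
  have inj : {in [set i | p i = e] &, injective (fun i => sval (f (PEdge i)))}.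
    by move=> i j _ _; apply: fI.
  move: (pk e); rewrite /has_card; case: (k) => [m|];
    exact: card_eq_trans (inj_card_eq inj).
split.
- apply: (card_edges _ true) => // [i tPi|F []//].
  by case e: (p i) => //; case: (facet_type_excl hG tPi (tQ i e)).
- apply: (card_edges _ false) => // [i tQi|F []//].
  by case e: (p i) => //; case: (facet_type_excl hG (tP i e) tQi).
exists f => // i /=; case e: (p i); [left|right]; split.
- exact: tP.
- by apply: tQ; rewrite ps e.
- exact: tQ.
- by apply: tP; rewrite ps e.
Qed.

End RankTwo.

Unset Implicit Arguments.
Set Strict Implicit.

Theorem theorem4p7 (gT : groupType) (n : nat) (a : nat -> gT) (b : gT)
    (k : option nat) (hG : tail_triangle_C_group n a b k) :
  let SG : ranked := S_poset n a b in
  let Fmin : SG := S_bot n a b in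
  let Fmax : SG := S_top n a b in
  let PP : ranked := string_poset n a in
  let QQ : ranked := string_poset n (tt_gensQ n a b) in
  let typeP : SG -> Prop := @facet_of_typeP gT n a b in
  let typeQ : SG -> Prop := @facet_of_typeQ gT n a b in
  (is_polytope n.+1 SG /\ is_semiregular n.+1 SG) /\
  ((forall F : SG, rk F = n%:Z%R ->
      [/\ typeP F, ~ typeQ F & isomorphic (section Fmin F) PP] \/
      [/\ typeQ F, ~ typeP F & isomorphic (section Fmin F) QQ]) /\
   (forall R : SG, rk R = (n%:Z - 2)%R ->
      [/\ has_card [set F : SG | typeP F /\ fle R F] k,
          has_card [set F : SG | typeQ F /\ fle R F] k
        & exists2 phi : polygon (omap double k) -> section R Fmax,
            is_iso phi
            & forall i : polygon_index (omap double k),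
                let F := sval (phi (PEdge i)) in
                let G := sval (phi (PEdge (polygon_succ i))) in
                (typeP F /\ typeQ G) \/ (typeQ F /\ typeP G)])) /\
  (forall F : SG, rk F = (n%:Z - 1)%R -> facewise_stabilizer F = [set 1%g]) /\
  ((2 <= n)%N ->
     let a0 := fun i => a i.+1 in
     let SG0 : ranked := S_poset n.-1 a0 b in
     [/\ tail_triangle_C_group n.-1 a0 b k,
         is_polytope n SG0 /\ is_semiregular n SG0
       & forall v : SG, rk v = 0%R -> isomorphic (section v Fmax) SG0]).
Proof.
split; first by split; [exact: (S_polytope hG)|exact: (S_semiregular hG)].
split; first by split; [exact: (S_facets hG)|exact: (corank2_faces hG)].
split; first exact: (ridge_stabilizer hG).
case: n hG => [|[|m]] // hG' _; have hG0 := vertex_tail_triangle hG' (ltn0Sn m).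
split; first exact: hG0.
  by split; [exact: (S_polytope hG0)|exact: (S_semiregular hG0)].
exact: (vertex_figure_iso hG' (ltn0Sn m)).
Qed.
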